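(* Let $\alpha=0$ and let $\mu$ be a delay distribution on $[0,1]$ with $\mathbb{P}(\xi=0)<1$ for $\xi\sim\mu$, such that $\eta=-\log(1-\xi)$ has a density $f_\eta$ on $[0,\infty)$ with $\sup_{u\ge0}e^uf_\eta(u)<\infty$, and such that Assumption (A) holds. Let $M(\rho,n)$ be the degree of the root $v_1$ in $\mathcal{T}(n)$. (a) (Upper bound) If $\mathbb{E}(e^{\gamma\eta})<\infty$ for all $\gamma>0$, there exists $C_1\in(0,\infty)$ such that for every $A>0$, $$\limsup_{n\to\infty}\mathbb{P}(M(\rho,n)>An^\lambda)\le \frac{C_1}{A^{1/(\lambda+1)}}.$$ (b) (Lower bound) If $\mathbb{E}(e^{\gamma\eta})<\infty$ for some $\gamma>1$, there exist finite positive constants $C_1,C_2$ such that for every $x>0$, $$\limsup_{n\to\infty}\mathbb{P}(M(\rho,n)<xn^\lambda)\le C_1x^{C_2}.$$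
   Context: Model ($\alpha=0$): $\mathcal{T}(1)$ is a single vertex $v_1$ (root); $\mathcal{T}(2)$ has vertices $v_1,v_2$ with $v_2$ a child of $v_1$; $\mathcal{T}(0):=\mathcal{T}(1)$. $\deg(v_i,j)$ is the degree of $v_i$ in $\mathcal{T}(j)$, with $\deg(v_i,i)=1$. For $n\ge2$, a new vertex $v_{n+1}$, with independent delay $\xi_{n+1}\sim\mu$, becomes a child of a vertex $v$ of $\mathcal{T}(\lfloor n-n\xi_{n+1}\rfloor)$ chosen with probability proportional to $\deg(v,\lfloor n-n\xi_{n+1}\rfloor)$. Let $F_\eta$ be the law of $\eta$ and $h(x)=\frac12\int_0^xe^udF_\eta(u)$. Let $\zeta_{\mathrm{e}}$ be a Poisson point process on $[0,\infty)$ with intensity $h(t)dt$ and $\hat\zeta_{\mathrm{e}}(s)=\int_0^\infty e^{-st}\zeta_{\mathrm{e}}(dt)$. Assumption (A): $\mathbb{E}(e^{\theta\eta})<\infty$ for some $\theta>0$; $\lambda>0$ is the unique solution of $\int_0^\infty e^{-\lambda t}h(t)dt=1$; and $\mathbb{E}(\hat\zeta_{\mathrm{e}}(\lambda)\log^+\hat\zeta_{\mathrm{e}}(\lambda))<\infty$. *)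

(* Defs.v *)
From HB Require Import structures.
From mathcomp Require Import all_boot all_order all_algebra.
From mathcomp Require Import all_classical all_reals all_analysis measurable_realfun.
Set Implicit Arguments. Unset Strict Implicit. Unset Printing Implicit Defensive.
Import Order.TTheory GRing.Theory Num.Theory.
Import numFieldNormedType.Exports.
Local Open Scope classical_set_scope.
Local Open Scope ring_scope.

(* A tree T(n) (n >= 1) on v_1..v_n is encoded by its parent list        *)
(*   s = [:: p_2; p_3; ...; p_n]   (p_j = index of the parent of v_j),   *)
(* with p_j in {1,..,j-1}.  T(k) for k <= n is encoded by take (k-1) s;  *)
(* T(0) = T(1) (take 0 s = [::]).                                        *)

(* all parent lists of length m (i.e. all trees T(m+1)) *)
Fixpoint pseqs (m : nat) : seq (seq nat) :=
  match m with
  | 0 => [:: [::]]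
  | m'.+1 => [seq rcons s i | s <- pseqs m', i <- iota 1 m'.+1]
  end.

(* deg(v_i, k): degree of v_i in T(k), with deg(v_i,i) = 1,
   i.e. 1 + number of children of v_i in T(k). *)
Definition deg (s : seq nat) (i k : nat) : nat :=
  1 + count (pred1 i) (take k.-1 s).

Section Process.
Variable R : realType.

Definition qdelay (mu : probability R R) (n k : nat) : R :=
  fine (mu [set x : R | Num.floor (n%:R - n%:R * x) = k%:Z]).

(* given T(n) encoded by t (size t = n - 1, n >= 2), probability that
   v_{n+1} becomes a child of v_i: average over the delay of the
   preferential-attachment probability in T(floor(n - n xi)). *)
Definition trans (mu : probability R R) (t : seq nat) (n i : nat) : R :=
  \sum_(0 <= k < n.+1)
     qdelay mu n k *
     (let K := maxn k 1 in
      if (1 <= i <= K)%N then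
        (deg t i K)%:R / (\sum_(1 <= u < K.+1) (deg t u K)%:R)
      else 0).

(* probability of the tree encoded by s (v_2 is deterministically a child of v_1) *)
Definition wt (mu : probability R R) (s : seq nat) : R :=
  \prod_(1 <= j < size s) trans mu (take j s) j.+1 (nth 0 s j).

Definition probRootDeg (mu : probability R R) (n : nat) (E : nat -> bool) : R :=
  \sum_(s <- pseqs n.-1) wt mu s * (E (deg s 1 n))%:R.

Definition nonneg_reals : set R := [set u | 0 <= u].

Definition eta_density (mu : probability R R) (f : R -> R) : Prop :=
  measurable_fun nonneg_reals f /\
  (forall u, 0 <= f u) /\
  (\int[lebesgue_measure]_(u in nonneg_reals) (f u)%:E = 1)%E /\
  (forall B : set R, measurable B ->
     mu [set x | 0 <= x < 1 /\ B (- ln (1 - x))] =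
     (\int[lebesgue_measure]_(u in B `&` nonneg_reals) (f u)%:E)%E).

Definition eta_expmoment (f : R -> R) (g : R) : \bar R :=
  (\int[lebesgue_measure]_(u in nonneg_reals) (expR (g * u) * f u)%:E)%E.

Definition hfun (f : R -> R) (x : R) : R :=
  fine (\int[lebesgue_measure]_(u in [set u : R | (0 <= u <= x)%R]) (expR u * f u)%:E)%E / 2.

Definition hLaplace (f : R -> R) (s : R) : \bar R :=
  (\int[lebesgue_measure]_(t in nonneg_reals) (expR (- s * t) * hfun f t)%:E)%E.

(* Poisson point processes on [0,oo) with intensity hh(t) dt,
   represented as a random (simple) set of points S w. *)
Definition ppcount (T : Type) (S : T -> set R) (w : T) (B : set R) : \bar R :=
  (\esum_(x in S w `&` B) 1)%E.

Definition intensity (hh : R -> R) (B : set R) : \bar R :=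
  (\int[lebesgue_measure]_(t in B `&` nonneg_reals) (hh t)%:E)%E.

Definition isPPP (d : measure_display) (Om : measurableType d)
    (P : probability Om R) (S : Om -> set R) (hh : R -> R) : Prop :=
  [/\ (forall w, S w `<=` nonneg_reals),
      (forall B, measurable B -> measurable_fun [set: Om] (fun w : Om => (ppcount S w B : \bar R))),
      (forall B, measurable B -> intensity hh B = +oo%E ->
          P [set w | ppcount S w B = +oo%E] = 1%E),
      (forall B (r : R), measurable B -> intensity hh B = r%:E ->
          forall k : nat,
          P [set w | ppcount S w B = (k%:R)%:E] =
            (expR (- r) * r ^+ k / (k`!)%:R)%:E) &
      (forall (m : nat) (B : 'I_m -> set R) (c : 'I_m -> nat),
          (forall i, measurable (B i)) ->
          (forall i j, i != j -> B i `&` B j = set0) ->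
          P (\bigcap_(i in [set: 'I_m]) [set w | ppcount S w (B i) = ((c i)%:R)%:E]) =
          (\prod_(i < m) P [set w | ppcount S w (B i) = ((c i)%:R)%:E])%E)].

(* hat zeta_e (s) = int e^{-s t} zeta_e(dt) *)
Definition zetahat (T : Type) (S : T -> set R) (s : R) (w : T) : \bar R :=
  (\esum_(x in S w) (expR (- s * x))%:E)%E.

Definition xlogplus (x : \bar R) : \bar R :=
  match x with
  | EFin r => (r * Num.max (ln r) 0)%:E
  | _ => +oo%E
  end.

Definition assumptionA (f : R -> R) (lam : R) : Prop :=
  [/\ (exists2 th : R, 0 < th & (eta_expmoment f th < +oo)%E),
      0 < lam,
      hLaplace f lam = 1%E,
      (forall l : R, hLaplace f l = 1%E -> l = lam) &
      (forall (d : measure_display) (Om : measurableType d)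
              (P : probability Om R) (S : Om -> set R),
         isPPP P S (hfun f) ->
         (\int[P]_w xlogplus (zetahat S lam w) < +oo)%E)].

End Process.

(* Main.v *)
(* Let X_n be the degree of the root in T(n).  Given T(n), the new vertex joins the
   root with probability L_n X = sum_k P(floor(n - n xi) = k) X_k / (2 k - 1), which is
   linear in the history, so E X_n solves m_(n+1) = m_n + L_n m.  The equation for lam
   reads E exp((1 - lam) eta) = 2 lam, which makes n^lam an approximate solution:
   n^lam exp(- K n^(- lam)) is a supersolution and, for m large,
   k^lam exp(K (m / k)^lam) on k >= m (and 0 below m) is a subsolution on n >= m.

   (a) The supersolution gives E X_n <= C n^lam, and Markov's inequality concludes.

   (b) For the lower tail one bounds E exp(- theta X_n).  Conditioning backwards in
   time keeps the form exp(- sum_k w_k X_k), up to an inequality.  Pairing the weights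
   with the supersolution bounds the top weight a_j at time j from above; pairing them
   with the subsolution and using a - (1 - exp(- a)) <= a^2 then shows that for
   theta = eps (m / n)^lam the top weight at time m stays above a constant.  Hence
   E exp(- theta X_n) <= E exp(- c X_m), and the latter decays like a power of m since
   the root gains a child at time j with probability at least 1 / (2 j).  Taking
   m of order x^(- 1 / lam) gives the claim. *)

Require Import Defs.
From HB Require Import structures.
From mathcomp Require Import all_boot all_order all_algebra.
From mathcomp Require Import all_classical all_reals all_analysis measurable_realfun.
From mathcomp Require Import zify ring lra.
Import Order.TTheory GRing.Theory Num.Theory.
Import numFieldNormedType.Exports.
Local Open Scope classical_set_scope.
Local Open Scope ring_scope.
Set Implicit Arguments. Unset Strict Implicit. Unset Printing Implicit Defensive.

(** * Parent lists and child counts *)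

Lemma pseqsP (m : nat) (s : seq nat) : s \in pseqs m ->
  size s = m /\ forall j, (j < m)%N -> (1 <= nth 0 s j <= j.+1)%N.
Proof.
elim: m s => [|m IH] s; first by rewrite inE => /eqP ->.
move=> /allpairsPdep [t [i [/IH [st ht] hi ->]]]; move: hi; rewrite mem_iota => hi.
split=> [|j]; first by rewrite size_rcons st.
rewrite nth_rcons st ltnS leq_eqVlt => /orP[/eqP ->|jm]; last by rewrite jm ht.
by rewrite ltnn eqxx; move: hi; rewrite add1n ltnS.
Qed.

Lemma sum_count_pred1 (K : nat) (s : seq nat) :
  all (fun x => (1 <= x <= K)%N) s ->
  (\sum_(1 <= u < K.+1) count (pred1 u) s = size s)%N.
Proof.
elim: s => [|x s IH] /=; first by rewrite big1.
move=> /andP[xK /IH {}IH]; rewrite big_split /= IH.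
rewrite (bigD1_seq x) ?iota_uniq ?mem_index_iota //= eqxx big1 // => u ux.
by rewrite eq_sym (negbTE ux).
Qed.

(** * The root degree of the tree *)

Section RootDegree.
Variables (R : realType) (mu : probability R R).

Definition expect (n : nat) (F : seq nat -> R) : R :=
  \sum_(s <- pseqs n.-1) wt mu s * F s.

(* With [g k] the degree of the root in T(k), [attach n g] is the conditional
   probability that v_(n+1) becomes a child of the root: the degrees of T(K) sum
   to 2K - 1 because the root carries one extra unit of degree.  The maximum
   encodes T(0) = T(1). *)
Definition attach (n : nat) (g : nat -> R) : R :=
  \sum_(0 <= k < n.+1)
     qdelay mu n k * (g (maxn k 1) / (2 * (maxn k 1)%:R - 1)).

Definition rootdeg (s : seq nat) (k : nat) : R := (deg s 1 k)%:R.

Lemma qdelay_ge0 n k : 0 <= qdelay mu n k.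
Proof. by rewrite /qdelay fine_ge0. Qed.

Lemma den_gt0 k : 0 < 2 * (maxn k 1)%:R - 1 :> R.
Proof.
have : 1 <= (maxn k 1)%:R :> R by rewrite ler1n leq_max leqnn orbT.
lra.
Qed.

Lemma attach_ge0 n g : (forall k, 0 <= g k) -> 0 <= attach n g.
Proof.
move=> g0; apply: sumr_ge0 => k _; apply: mulr_ge0; first exact: qdelay_ge0.
by apply: divr_ge0 => //; apply: ltW; exact: den_gt0.
Qed.

Lemma le_attach n g h : (0 < n)%N ->
  (forall k, (1 <= k <= n)%N -> g k <= h k) -> attach n g <= attach n h.
Proof.
move=> n0 gh; rewrite /attach !big_nat; apply: ler_sum => k /andP[_ kn].
apply: ler_wpM2l; first exact: qdelay_ge0.
by rewrite ler_pM2r ?invr_gt0 ?den_gt0 // gh //; move: kn n0; lia.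
Qed.

Lemma attachZ n c g : attach n (fun k => c * g k) = c * attach n g.
Proof.
rewrite /attach mulr_sumr; apply: eq_bigr => k _; ring.
Qed.

(** Each of the K vertices contributes its extra unit, and each of the K - 1 edges is counted once,
    at the parent. *)
Lemma sum_deg n s K : s \in pseqs n.-1 -> (1 <= K <= n)%N ->
  \sum_(1 <= u < K.+1) (deg s u K)%:R = 2 * K%:R - 1 :> R.
Proof.
move=> /pseqsP [ss hs] K1; rewrite -natr_sum.
have -> : (\sum_(1 <= u < K.+1) deg s u K = K + K.-1)%N.
  rewrite /deg big_split /= sum_nat_const_nat muln1 subSS subn0.
  rewrite sum_count_pred1.
    by rewrite size_takel // ss; move: K1; lia.
  apply/(all_nthP 0%N) => j; rewrite size_takel ?ss; last by move: K1; lia.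
  move=> jK; rewrite nth_take //.
  by have := hs j; move: K1 jK; lia.
rewrite natrD; case: K K1 => // K _ /=.
rewrite -natr1; ring.
Qed.

Hypothesis sum_qdelay : forall n, \sum_(0 <= k < n.+1) qdelay mu n k = 1.

(** After exchanging the sums, the attachment probabilities within each T(K) add up to 1, and then
    so do the delay probabilities. *)
Lemma sum_trans n s : (0 < n)%N -> s \in pseqs n.-1 ->
  \sum_(1 <= i < n.+1) trans mu s n i = 1.
Proof.
move=> n0 hs; rewrite /trans exchange_big /= -[RHS](sum_qdelay n) big_nat [RHS]big_nat.
apply: eq_bigr => k /andP[_ kn]; rewrite -mulr_sumr.
set K := maxn k 1.
have Kn : (1 <= K <= n)%N by rewrite /K; move: kn n0; lia.
rewrite -[X in _ * X]big_mkcond /= -mulr_suml.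
rewrite (_ : \sum_(1 <= i < n.+1 | _) _ = \sum_(1 <= u < K.+1) (deg s u K)%:R); last first.
  rewrite (big_cat_nat (n := K.+1)) //=; last by move: Kn; lia.
  rewrite [X in _ + X]big_nat_cond [X in _ + X]big_pred0 ?addr0; last by move=> i; lia.
  by rewrite big_nat_cond [RHS]big_nat_cond; apply: eq_bigl => i; lia.
rewrite divff ?mulr1 // (sum_deg hs) // gt_eqF // den_gt0 //.
Qed.

Lemma trans_ge0 s n i : 0 <= trans mu s n i.
Proof.
apply: sumr_ge0 => k _; apply: mulr_ge0; first exact: qdelay_ge0.
cbv zeta; case: (1 <= i <= maxn k 1)%N => //; apply: divr_ge0 => //; apply: sumr_ge0 => *; exact: ler0n.
Qed.

Lemma trans_root n s : (0 < n)%N -> s \in pseqs n.-1 ->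
  trans mu s n 1 = attach n (rootdeg s).
Proof.
move=> n0 hs; rewrite /trans /attach big_nat [RHS]big_nat.
apply: eq_bigr => k /andP[_ kn]; rewrite leq_max leqnn orbT /=.
by rewrite (sum_deg hs) //; move: kn n0; lia.
Qed.

(** If only hitting the root matters, the step is a Bernoulli trial with parameter
    [attach n (rootdeg s)]. *)
Lemma sum_trans_root n s (phi : bool -> R) : (0 < n)%N -> s \in pseqs n.-1 ->
  let p := attach n (rootdeg s) in
  \sum_(1 <= i < n.+1) trans mu s n i * phi (i == 1%N)
    = p * phi true + (1 - p) * phi false.
Proof.
move=> n0 hs p; have := sum_trans n0 hs.
rewrite big_ltn // (trans_root n0 hs) -/p => h.
rewrite big_ltn // (trans_root n0 hs) eqxx -/p.
have -> : 1 - p = \sum_(2 <= i < n.+1) trans mu s n i by rewrite -h; ring.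
congr (_ + _); rewrite mulr_suml !big_nat; apply: eq_bigr => i /andP[i2 _].
by rewrite (_ : (i == 1%N) = false) //; lia.
Qed.

Lemma wt_ge0 s : 0 <= wt mu s.
Proof. by apply: prodr_ge0 => j _; exact: trans_ge0. Qed.

Lemma wt_rcons s i : (0 < size s)%N ->
  wt mu (rcons s i) = wt mu s * trans mu s (size s).+1 i.
Proof.
move=> s0; rewrite /wt size_rcons big_nat_recr //=.
rewrite -cats1 take_size_cat // nth_cat ltnn subnn /=; congr (_ * _).
rewrite !big_nat; apply: eq_bigr => j /andP[_ js].
by rewrite takel_cat ?(ltnW js) // nth_cat js.
Qed.

(** Tower property: condition on T(n) and average over the parent of the new vertex. It starts at n
    = 2 because v_2 is attached deterministically. *)
Lemma expectS n F : (1 < n)%N -> expect n.+1 F =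
  expect n (fun s => \sum_(1 <= i < n.+1) trans mu s n i * F (rcons s i)).
Proof.
case: n => [//|[//|n]] _; rewrite /expect !succnK.
rewrite -[pseqs n.+2]/[seq rcons s i | s <- pseqs n.+1, i <- iota 1 n.+2].
rewrite big_allpairs_dep big_seq [RHS]big_seq.
apply: eq_bigr => s /pseqsP [ss _]; rewrite mulr_sumr.
rewrite /index_iota subn1 /=; apply: eq_bigr => i _.
by rewrite wt_rcons ss // mulrA.
Qed.

Lemma le_expect n F G : (forall s, s \in pseqs n.-1 -> F s <= G s) ->
  expect n F <= expect n G.
Proof.
move=> FG; rewrite /expect big_seq [leRHS]big_seq; apply: ler_sum => s hs.
by apply: ler_wpM2l; [exact: wt_ge0|exact: FG].
Qed.

Lemma eq_expect n F G : (forall s, s \in pseqs n.-1 -> F s = G s) ->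
  expect n F = expect n G.
Proof.
by move=> FG; apply/eqP; rewrite eq_le !le_expect // => s hs; rewrite FG.
Qed.

Lemma expectZ n c F : expect n (fun s => c * F s) = c * expect n F.
Proof. by rewrite /expect mulr_sumr; apply: eq_bigr => s _; rewrite mulrCA. Qed.

Lemma expectD n F G : expect n (fun s => F s + G s) = expect n F + expect n G.
Proof. by rewrite /expect -big_split /=; apply: eq_bigr => s _; rewrite mulrDr. Qed.

Lemma expect_sum n (I : Type) (r : seq I) (c : I -> R) (F : I -> seq nat -> R) :
  expect n (fun s => \sum_(i <- r) c i * F i s) = \sum_(i <- r) c i * expect n (F i).
Proof.
rewrite /expect; under eq_bigr do rewrite mulr_sumr.
rewrite exchange_big; apply: eq_bigr => i _; rewrite mulr_sumr.
by apply: eq_bigr => s _; rewrite mulrCA.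
Qed.

Lemma expect2 F : expect 2 F = F [:: 1%N].
Proof.
by rewrite /expect /= !big_cons big_nil /wt big_geq // mul1r addr0.
Qed.

Lemma expect_cst n c : (1 < n)%N -> expect n (fun=> c) = c.
Proof.
elim: n => [//|n IH]; rewrite leq_eqVlt => /orP[/eqP <-|n1]; first by rewrite expect2.
rewrite expectS // -[RHS]IH //; apply: eq_expect => s hs.
by rewrite -mulr_suml sum_trans ?mul1r //; move: n1; lia.
Qed.

Lemma rootdeg_rcons n s i k : (0 < n)%N -> s \in pseqs n.-1 -> (k <= n)%N ->
  rootdeg (rcons s i) k = rootdeg s k.
Proof.
move=> n0 /pseqsP [ss _] kn; rewrite /rootdeg /deg -cats1 takel_cat // ss.
by move: n0 kn; lia.
Qed.

Lemma rootdeg_rcons_last n s i : (0 < n)%N -> s \in pseqs n.-1 ->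
  rootdeg (rcons s i) n.+1 = rootdeg s n + (i == 1%N)%:R.
Proof.
move=> n0 /pseqsP [ss _]; rewrite /rootdeg /deg /= !take_oversize; first last.
- by rewrite size_rcons ss; move: n0; lia.
- by rewrite ss.
by rewrite -cats1 count_cat /= addn0 -natrD addnA.
Qed.

Lemma rootdeg_ge1 s k : 1 <= rootdeg s k.
Proof. by rewrite /rootdeg /deg ler1n. Qed.

(** Later vertices leave T(k) unchanged, and their transition probabilities sum to 1. *)
Lemma expect_rootdeg_stable k n : (1 < k <= n)%N ->
  expect n (rootdeg^~ k) = expect k (rootdeg^~ k).
Proof.
elim: n => [|n IH]; first by lia.
rewrite (leq_eqVlt k) => /andP[k1 /orP[/eqP <- //|kn]].
rewrite -IH; last by move: k1 kn; lia.
have n1 : (1 < n)%N by move: k1 kn; lia.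
rewrite expectS //; apply: eq_expect => s hs.
rewrite (eq_bigr (fun i => trans mu s n i * rootdeg s k)); last first.
  by move=> i _; rewrite (rootdeg_rcons i _ hs) //; move: n1; lia.
by rewrite -mulr_suml sum_trans ?mul1r //; move: n1; lia.
Qed.

Definition meandeg (k : nat) : R := if (k <= 1)%N then 1 else expect k (rootdeg^~ k).

Lemma expect_rootdeg k n : (1 < n)%N -> (0 < k <= n)%N ->
  expect n (rootdeg^~ k) = meandeg k.
Proof.
move=> n1 kn; rewrite /meandeg; case: ifP => k1; last first.
  by rewrite expect_rootdeg_stable //; move: kn k1; lia.
have -> : k = 1%N by move: kn k1; lia.
rewrite -[RHS](expect_cst 1 n1); apply: eq_expect => s _.
by rewrite /rootdeg /deg /= take0 /= addn0.
Qed.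

(** [attach] is linear in the history, so the expectation passes through it. *)
Lemma meandegS n : (1 < n)%N -> meandeg n.+1 = meandeg n + attach n meandeg.
Proof.
move=> n1; have n0 : (0 < n)%N by apply: ltnW.
rewrite {1}/meandeg ltnNge n0 /= expectS //.
rewrite -(expect_rootdeg n1 (k := n)); last by rewrite n0 leqnn.
have -> : attach n meandeg = expect n (fun s => attach n (rootdeg s)).
  rewrite /attach (expect_sum _ _ (qdelay mu n)
    (fun k s => rootdeg s (maxn k 1) / (2 * (maxn k 1)%:R - 1))).
  rewrite big_nat [RHS]big_nat; apply: eq_bigr => k /andP[_ kn].
  congr (_ * _); rewrite mulrC -(expect_rootdeg n1); last by move: n0 kn; lia.
  by rewrite -expectZ; apply: eq_expect => s _; rewrite mulrC.
rewrite -expectD; apply: eq_expect => s hs.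
under eq_bigr do rewrite (rootdeg_rcons_last _ n0 hs).
rewrite (sum_trans_root (fun b : bool => rootdeg s n + b%:R) n0 hs) /=; ring.
Qed.

Lemma probRootDegE n E : probRootDeg mu n E = expect n (fun s => (E (deg s 1 n))%:R).
Proof. by []. Qed.

Lemma probRootDeg_ge0 n E : 0 <= probRootDeg mu n E.
Proof. by apply: sumr_ge0 => s _; rewrite mulr_ge0 ?wt_ge0. Qed.

Lemma probRootDeg_le1 n E : (1 < n)%N -> probRootDeg mu n E <= 1.
Proof.
move=> n1; rewrite probRootDegE -[leRHS](expect_cst 1 n1); apply: le_expect => s _.
by case: (E _); rewrite /= ?lexx ?ler01.
Qed.

Lemma attach_rootdeg_ge n s : (0 < n)%N -> (2 * n%:R)^-1 <= attach n (rootdeg s).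
Proof.
move=> n0; rewrite -[leLHS]mul1r -[X in X * _](sum_qdelay n) mulr_suml /attach !big_nat.
apply: ler_sum => k /andP[_ kn]; apply: ler_wpM2l; first exact: qdelay_ge0.
have Kn : (maxn k 1)%:R <= n%:R :> R by rewrite ler_nat; move: n0 kn; lia.
have K1 : 1 <= (maxn k 1)%:R :> R by rewrite ler1n leq_max leqnn orbT.
rewrite ler_pdivlMr; last exact: den_gt0.
apply: le_trans (rootdeg_ge1 _ _).
rewrite mulrC ler_pdivrMr ?mul1r; lra.
Qed.

End RootDegree.

Lemma floor_eq_nat (R : realType) (x : R) (k : nat) :
  Num.floor x = k%:Z <-> k%:R <= x < k.+1%:R.
Proof.
have e : (k%:Z + 1)%:~R = k.+1%:R :> R by rewrite intrD mulr1z -pmulrn natr1.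
split=> [h|h]; last by apply: floor_def; rewrite e.
by have := floor_itv x; rewrite h e.
Qed.

(** * Moments of the delay *)

Section DelayMoments.
Variables (R : realType) (mu : probability R R) (f : R -> R).
Hypothesis fdens : eta_density mu f.

Notation leb := (@lebesgue_measure R).
Notation D := (@nonneg_reals R).

Lemma nonneg_realsE : D = `[0, +oo[%classic.
Proof. by rewrite set_itvE. Qed.

Lemma measurable_nonneg_reals : measurable D.
Proof. by rewrite nonneg_realsE. Qed.
Hint Resolve measurable_nonneg_reals : core.

Let mf : measurable_fun D f. Proof. by case: fdens. Qed.
Let f0 u : 0 <= f u. Proof. by case: fdens => _ []. Qed.

Lemma measurable_expMf (g : R) : measurable_fun D (fun u => expR (g * u) * f u).
Proof.
by apply: measurable_funM => //; apply: measurableT_comp.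
Qed.

Lemma integrable_expMf (g : R) : (eta_expmoment f g < +oo)%E ->
  leb.-integrable D (EFin \o (fun u => expR (g * u) * f u)).
Proof.
move=> h; apply/integrableP; split.
  by apply/measurable_EFinP; exact: measurable_expMf.
apply: le_lt_trans h; rewrite le_eqVlt; apply/orP; left; apply/eqP.
apply: eq_integral => u _ /=.
by rewrite ger0_norm // mulr_ge0 ?expR_ge0.
Qed.

Lemma expmoment0 : eta_expmoment f 0 = 1%E.
Proof.
case: fdens => _ [_ [h _]]; rewrite -h; apply: eq_integral => u _.
by rewrite mul0r expR0 mul1r.
Qed.

Lemma integrable_f : leb.-integrable D (EFin \o f).
Proof.
have := @integrable_expMf 0; rewrite expmoment0 => /(_ (ltry _)).
apply: eq_integrable => // u _ /=.
by rewrite mul0r expR0 mul1r.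
Qed.

Definition floorset (n k : nat) : set R :=
  [set u | Num.floor (n%:R * expR (- u)) = k%:Z].

Lemma measurable_floorset n k : measurable (floorset n k).
Proof.
have -> : floorset n k = (fun u => n%:R * expR (- u)) @^-1` `[k%:R, k.+1%:R[%classic.
  apply/seteqP; split => u; rewrite /floorset /= in_itv /=.
    by move/floor_eq_nat.
  by move=> h; apply/floor_eq_nat.
rewrite -[X in measurable X]setTI.
suff : measurable_fun setT (fun u : R => n%:R * expR (- u)) by apply.
apply: measurable_funM => //; apply: measurableT_comp => //.
Qed.

(** The density has total mass 1, so xi lies in [0, 1) almost surely. *)
Lemma mu_setI_unit A : measurable A ->
  mu A = mu (A `&` [set x | 0 <= x < 1]).
Proof.
move=> mA.
have mU : measurable [set x : R | 0 <= x < 1].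
  by have -> : [set x : R | 0 <= x < 1] = `[0, 1[%classic by rewrite set_itvE.
have U1 : mu [set x | 0 <= x < 1] = 1%E.
  case: fdens => _ [_ [h1 /(_ setT measurableT)]].
  rewrite setTI h1 => <-; congr (mu _).
  by apply/seteqP; split => x /=; [split|case].
have U0 : mu (~` [set x | 0 <= x < 1]) = 0%E.
  by rewrite probability_setC // U1 subee.
have A0 : mu (A `&` ~` [set x | 0 <= x < 1]) = 0%E.
  apply/eqP; rewrite eq_le measure_ge0 andbT -U0.
  apply: le_measure; rewrite ?inE; [|exact: measurableC|exact: subIsetr].
  by apply: measurableI => //; exact: measurableC.
transitivity (mu ((A `&` [set x | 0 <= x < 1]) `|` (A `&` ~` [set x | 0 <= x < 1]))).
  by rewrite -setIUr setUv setIT.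
rewrite -[RHS]adde0 -[X in _ = (_ + X)%E]A0; apply: measureU.
- exact: measurableI.
- by apply: measurableI => //; exact: measurableC.
- by rewrite setIACA setICr setI0.
Qed.

(* The event floor(n - n xi) = k is the event floor(n exp(- eta)) = k. *)
Lemma qdelayE n k :
  qdelay mu n k = \int[leb]_(u in D) (f \_ (floorset n k)) u.
Proof.
rewrite -Rintegral_mkcondr setIC /qdelay /Rintegral; congr fine.
case: fdens => _ [_ [_ <-]]; last exact: measurable_floorset.
rewrite mu_setI_unit.
  congr (mu _); apply/seteqP; split => x /=; rewrite /floorset /= opprK.
    by move=> [h /andP[x0 x1]]; rewrite x0 x1 lnK ?posrE ?subr_gt0 // mulrBr mulr1.
  by move=> [/andP[x0 x1]]; rewrite x0 x1 lnK ?posrE ?subr_gt0 // mulrBr mulr1.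
have -> : [set x : R | Num.floor (n%:R - n%:R * x) = k%:Z] =
    (fun x => n%:R - n%:R * x) @^-1` `[k%:R, k.+1%:R[%classic.
  apply/seteqP; split => u; rewrite /= in_itv /=.
    by move/floor_eq_nat.
  by move=> h; apply/floor_eq_nat.
rewrite -[X in measurable X]setTI.
suff : measurable_fun setT (fun x : R => n%:R - n%:R * x) by apply.
by apply: measurable_funB => //; apply: measurable_funM.
Qed.

Lemma integrable_floorset n k :
  leb.-integrable D (EFin \o (f \_ (floorset n k))).
Proof.
rewrite -restrict_EFin; apply/integrable_restrict => //.
  exact: measurable_floorset.
apply: integrableS integrable_f => //.
by apply: measurableI => //; exact: measurable_floorset.
Qed.

Lemma Rintegral_sum (I : Type) (r : seq I) (g : I -> R -> R) :
  (forall i, leb.-integrable D (EFin \o g i)) ->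
  leb.-integrable D (EFin \o (fun u => \sum_(i <- r) g i u)) /\
  \int[leb]_(u in D) (\sum_(i <- r) g i u) = \sum_(i <- r) \int[leb]_(u in D) g i u.
Proof.
move=> ig; elim: r => [|i r [IH1 IH2]].
  split; last by rewrite big_nil /Rintegral integral0_eq // => u _; rewrite big_nil.
  apply: eq_integrable (integrable0 _ _) => // u _; by rewrite /= big_nil.
split.
  apply: eq_integrable (integrableD _ (ig i) IH1) => // u _.
  by rewrite /= big_cons.
rewrite big_cons -IH2 -RintegralD //; apply: eq_Rintegral => u _.
by rewrite big_cons.
Qed.

Lemma floor_expRN_le n (u : R) : 0 <= u ->
  exists2 k, (k <= n)%N & Num.floor (n%:R * expR (- u)) = k%:Z.
Proof.
move=> u0.
have x0 : 0 <= n%:R * expR (- u) :> R by rewrite mulr_ge0 ?expR_ge0.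
have : 0 <= Num.floor (n%:R * expR (- u)) by rewrite floor_ge0.
case E : (Num.floor _) => [k|//] _; exists k => //.
move/floor_eq_nat: E => /andP[kx _]; rewrite -(@ler_nat R); apply: le_trans kx _.
by rewrite ler_piMr // -expR0 ler_expR oppr_le0.
Qed.

(** For u >= 0 exactly one [floorset n k] with k <= n contains u, so the sum is the integral of
    psi(floor(n exp(- u))) f(u), and G dominates this psi pointwise. *)
Lemma sum_qdelay_le (n : nat) (psi : nat -> R) (G : R -> R) :
  leb.-integrable D (EFin \o (fun u => G u * f u)) ->
  (forall u k, 0 <= u -> Num.floor (n%:R * expR (- u)) = k%:Z -> psi k <= G u) ->
  \sum_(0 <= k < n.+1) qdelay mu n k * psi k <= \int[leb]_(u in D) (G u * f u).
Proof.
move=> iG hG.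
pose h k u := psi k * (f \_ (floorset n k)) u.
have ih k : leb.-integrable D (EFin \o h k).
  by apply: eq_integrable (integrableZl _ (psi k) (integrable_floorset n k)).
have [i1 i2] := Rintegral_sum (index_iota 0 n.+1) ih.
rewrite (eq_bigr (fun k => \int[leb]_(u in D) h k u)); last first.
  move=> k _; rewrite qdelayE mulrC; apply/esym.
  by apply: RintegralZl => //; exact: integrable_floorset.
rewrite -i2; apply: le_Rintegral => // u u0.
have [k kn E] := floor_expRN_le n u0.
rewrite (bigD1_seq k) ?iota_uniq ?mem_index_iota //= big1 ?addr0.
  rewrite /h patchE ifT; last by rewrite inE.
  by apply: ler_wpM2r => //; exact: hG.
move=> j jk; rewrite /h patchE ifF ?mulr0 //; apply: memNset => E'.
by move: jk; rewrite -eqz_nat -E -[in X in X != _]E' eqxx.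
Qed.

(** The preceding bound with the constant 1 gives one inequality, with the constant -1 the other. *)
Lemma sum_qdelay n : \sum_(0 <= k < n.+1) qdelay mu n k = 1.
Proof.
have i1 c : leb.-integrable D (EFin \o (fun u => c * f u)).
  by apply: eq_integrable (integrableZl _ c integrable_f).
have e1 : \int[leb]_(u in D) f u = 1.
  by case: fdens => _ [_ [h _]]; rewrite /Rintegral h.
apply/eqP; rewrite eq_le; apply/andP; split.
  have := @sum_qdelay_le n (fun=> 1) (fun=> 1) (i1 1).
  under eq_bigr do rewrite mulr1.
  by rewrite RintegralZl ?e1 ?mulr1 //; [apply|exact: integrable_f].
have := @sum_qdelay_le n (fun=> -1) (fun=> -1) (i1 (-1)).
under eq_bigr do rewrite mulrN1.
rewrite sumrN RintegralZl ?e1 ?mulr1 ?lerN2 //; last exact: integrable_f.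
by apply.
Qed.

End DelayMoments.

(** * The Laplace transform of h and the equation for [lam] *)

Section Laplace.
Variable (R : realType).
Notation leb := (@lebesgue_measure R).
Notation D := (@nonneg_reals R).

Lemma is_derive_expRN_prim (lam t : R) : 0 < lam ->
  is_derive t 1 (fun t : R => - (expR (- lam * t) / lam)) (expR (- lam * t)).
Proof.
move=> l0.
have h1 : is_derive t (1:R) (fun t : R => - lam * t) (- lam * 1).
  exact: (@is_deriveZ _ _ _ id (-lam) t 1 1).
rewrite mulr1 in h1.
have h2 : is_derive t (1:R) (expR \o (fun t : R => - lam * t))
    (expR (- lam * t) * - lam) by exact: is_derive1_comp.
have h3 : is_derive t (1:R) (- lam^-1 \*: (expR \o (fun t : R => - lam * t)))
    (- lam^-1 *: (expR (- lam * t) * - lam)) by exact: is_deriveZ.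
rewrite (_ : (fun _ => _) = (- lam^-1 \*: (expR \o (fun t : R => - lam * t)))).
  rewrite (_ : expR (- lam * t) = - lam^-1 *: (expR (- lam * t) * - lam)) //.
  by rewrite /GRing.scale /= mulrN mulrNN mulrCA mulVf ?mulr1 // gt_eqF.
apply/funext => x /=; rewrite /GRing.scale /= [RHS]mulNr; congr (- _); exact: mulrC.
Qed.

Lemma integral_expRN_itvcy (lam u : R) : 0 < lam ->
  (\int[leb]_(t in `[u, +oo[) (expR (- lam * t))%:E = (expR (- lam * u) / lam)%:E)%E.
Proof.
move=> lam0.
have cE : continuous (fun t : R => expR (- lam * t)).
  move=> t; apply: continuous_comp; last exact: continuous_expR.
  by apply: cvgM; [exact: cvg_cst|exact: cvg_id].
rewrite (@ge0_continuous_FTC2y _ _ (fun t => - (expR (- lam * t) / lam)) _ 0) //.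
- by rewrite EFinN oppeK add0e.
- exact: continuous_subspaceT.
- rewrite -oppr0; apply: cvgN; rewrite -(mul0r lam^-1); apply: cvgMl.
  rewrite (_ : (fun x => expR (- lam * x)) =
               (fun z => expR (- z)) \o (fun z => lam * z)); last first.
    by apply: eq_fun => x; rewrite mulNr.
  apply: (@cvg_comp _ _ _ _ _ _ (pinfty_nbhs R)); last exact: cvgr_expR.
  exact: gt0_cvgMry.
- by apply: cvgN; apply: cvgMl; apply/cvg_at_right_filter; exact: cE.
- by move=> x _; rewrite derive1E; have := @is_derive_expRN_prim lam x lam0; case.
Qed.

Variables (mu : probability R R) (f : R -> R).
Hypothesis fdens : eta_density mu f.

Let mD : measurable D. Proof. exact: measurable_nonneg_reals. Qed.
Let f0 u : 0 <= f u. Proof. by case: fdens => _ []. Qed.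
Let mf : measurable_fun D f. Proof. by case: fdens. Qed.

Let expf u := expR u * f u.
Let expf0 u : 0 <= expf u. Proof. by rewrite mulr_ge0 ?expR_ge0. Qed.
Let mexpf : measurable_fun D expf.
Proof. by apply: measurable_funM => //; apply: measurable_funTS. Qed.

(** On [0, t] the factor exp(u) is at most exp(t), so the integral is finite and the [fine] in
    [hfun] loses nothing. *)
Lemma hfunE t : 
  ((hfun f t)%:E = 2^-1%:E * \int[leb]_(u in [set u : R | (0 <= u <= t)%R]) (expf u)%:E)%E.
Proof.
have mt : measurable [set u : R | (0 <= u <= t)%R].
  by have -> : [set u : R | (0 <= u <= t)%R] = `[0, t]%classic by rewrite set_itvE.
have tD : [set u : R | (0 <= u <= t)%R] `<=` D by move=> u /= /andP[].
have ft : leb.-integrable [set u : R | (0 <= u <= t)%R] (EFin \o f).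
  by apply: integrableS (integrable_f fdens).
have it : leb.-integrable [set u : R | (0 <= u <= t)%R] (EFin \o expf).
  apply: le_integrable (integrableZl _ (expR t) ft) => //.
    by apply/measurable_EFinP; apply: measurable_funS mexpf.
  move=> u /= /andP[u0 ut]; rewrite lee_fin !ger0_norm ?mulr_ge0 ?expR_ge0 //.
  by rewrite ler_wpM2r // ler_expR.
rewrite /hfun mulrC EFinM fineK //.
exact: integrable_fin_num it.
Qed.

(* Tonelli applied to exp(- lam t) exp(u) f(u) on 0 <= u <= t turns the equation
   defining lam into a moment identity for eta. *)
Lemma expmoment_laplace (lam : R) : 0 < lam -> hLaplace f lam = 1%E ->
  eta_expmoment f (1 - lam) = (2 * lam)%:E.
Proof.
move=> lam0 hL.
(* The integrand is extended by 0, so that both iterated integrals run over the whole line. *)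
pose T := (fun p : R * R => (expR (- lam * p.1) / 2 * (\1_[set q : R * R | 0 <= q.2 <= q.1] p * (expf \_ D) p.2))%:E).
have T0 p : (0 <= T p)%E.
  rewrite lee_fin !mulr_ge0 ?expR_ge0 ?invr_ge0 //.
  by rewrite patchE; case: ifP.
have mT : measurable_fun setT T.
  apply/measurable_EFinP; apply: measurable_funM.
    apply: measurable_funM => //.
    by apply: measurableT_comp => //; apply: measurable_funM.
  apply: measurable_funM.
    apply: measurable_indic.
    rewrite (_ : [set q : R * R | 0 <= q.2 <= q.1] =
       [set q | 0 <= q.2] `&` [set q | q.2 <= q.1]).
      apply: measurableI; rewrite -[X in measurable X]setTI.
        exact: measurable_fun_le.
      exact: measurable_fun_le.
    by apply/seteqP; split => q /=; [move/andP|move=> [-> ->]].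
  apply: (measurableT_comp (f := expf \_ D)) => //.
  exact/(measurable_restrictT _ mD).
have := fubini_tonelli (m1 := leb) (m2 := leb) T mT T0.
have mI (t : R) : measurable [set u : R | (0 <= u <= t)%R].
  by have -> : [set u : R | (0 <= u <= t)%R] = `[0, t]%classic by rewrite set_itvE.
(* Integrating over u first produces exp(- lam t) h(t). *)
have -> : (\int[leb]_t \int[leb]_u T (t, u) = 1)%E.
  rewrite -hL /hLaplace [RHS]integral_mkcond; apply: eq_integral => t _.
  have -> : (\int[leb]_u T (t, u) =
      (expR (- lam * t) / 2)%:E * \int[leb]_(u in [set u : R | (0 <= u <= t)%R]) (expf u)%:E)%E.
    rewrite [in RHS]integral_mkcond -ge0_integralZl //.
    - apply: eq_integral => u _; rewrite /T /= EFinM; congr (_ * _)%E.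
      rewrite !patchE indicE; case: (boolP (0 <= u <= t)) => h.
        by rewrite !ifT ?mem_set //= ?mul1r //; case/andP: h.
      have -> : (u \in [set u : R | (0 <= u <= t)%R]) = false by apply: memNset; apply/negP.
      have -> : ((t, u) \in [set q : R * R | 0 <= q.2 <= q.1]) = false.
        by apply: memNset; apply/negP.
      by rewrite mul0r.
    - apply/(measurable_restrictT _ (mI t)); apply/measurable_EFinP.
      by apply: measurable_funS mexpf => // u /= /andP[].
    - by move=> u _; rewrite patchE; case: ifP => // _; rewrite lee_fin.
  rewrite patchE; case: ifPn => tD.
    by rewrite [RHS]EFinM hfunE EFinM -muleA.
  rewrite integral0_eq ?mule0 // => u /andP[u0 ut].
  by move: tD; rewrite mem_set //=; exact: le_trans ut.
(* Integrating over t >= u first gives exp(- lam u) / lam, which turns exp(u) into exp((1 - lam) u)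
   and 1 / 2 into 1 / (2 lam). *)
have -> : (\int[leb]_u \int[leb]_t T (t, u) = (2 * lam)^-1%:E * eta_expmoment f (1 - lam))%E.
  rewrite /eta_expmoment -ge0_integralZl //.
  - rewrite [RHS]integral_mkcond; apply: eq_integral => u _; rewrite [RHS]patchE.
    case: ifPn => uD; last first.
      by apply: integral0_eq => t _; rewrite /T /= patchE (negbTE uD) !mulr0.
    transitivity ((expf u / 2)%:E * \int[leb]_(t in `[u, +oo[) (expR (- lam * t))%:E)%E.
      rewrite [in RHS]integral_mkcond -ge0_integralZl //.
      + apply: eq_integral => t _; rewrite /T /= !patchE uD indicE.
        have u0 : 0 <= u by move: uD; rewrite inE.
        case: (boolP (u <= t)) => ut.
          have -> : (t \in `[u, +oo[%classic) by rewrite mem_set //= in_itv /= ut.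
          have -> : ((t, u) \in [set q : R * R | 0 <= q.2 <= q.1]).
            by rewrite mem_set //= u0.
          by rewrite mul1r -EFinM; congr (_%:E); ring.
        have -> : (t \in `[u, +oo[%classic) = false.
          by apply: memNset; rewrite /= in_itv /= andbT; apply/negP.
        have -> : ((t, u) \in [set q : R * R | 0 <= q.2 <= q.1]) = false.
          by apply: memNset; rewrite /= u0 /=; apply/negP.
        by rewrite mul0r mulr0 mule0.
      + apply/(measurable_restrictT _ (measurable_itv _)); apply/measurable_EFinP.
        by apply: measurable_funTS; apply: measurableT_comp.
      + by move=> t _; rewrite patchE; case: ifP => // _; rewrite lee_fin expR_ge0.
      + by rewrite lee_fin divr_ge0.
    rewrite integral_expRN_itvcy // -!EFinM; congr (_%:E).
    rewrite /expf mulrBl mul1r mulNr expRD invfM; ring.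
  - by apply/measurable_EFinP; exact: measurable_expMf fdens _.
  - by move=> u _; rewrite lee_fin mulr_ge0 ?expR_ge0.
  - by rewrite lee_fin invr_ge0 mulr_ge0 // ltW.
move=> e; rewrite -[RHS]mule1 e muleA -EFinM divff ?mul1e //.
by rewrite mulf_neq0 // gt_eqF.
Qed.

(** For lam >= 1 the moment E exp((1 - lam) eta) would be at most 1, whereas it equals 2 lam >=
    2. *)
Lemma laplace_root_lt1 (lam : R) : 0 < lam -> hLaplace f lam = 1%E -> lam < 1.
Proof.
move=> lam0 hL; rewrite ltNge; apply/negP => lam1.
have := expmoment_laplace lam0 hL.
have : (eta_expmoment f (1 - lam) <= eta_expmoment f 0)%E.
  apply: ge0_le_integral => //.
  - by move=> u _; rewrite lee_fin mulr_ge0 ?expR_ge0.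
  - by apply/measurable_EFinP; exact: measurable_expMf fdens _.
  - by apply/measurable_EFinP; exact: measurable_expMf fdens _.
  - move=> u u0; rewrite lee_fin ler_wpM2r // ler_expR ler_wpM2r //.
    by rewrite subr_le0.
rewrite (expmoment0 fdens) => h1 h2; move: h1; rewrite h2 lee_fin; lra.
Qed.

Lemma expmoment_fin (g g' : R) : g <= g' -> (eta_expmoment f g' < +oo)%E ->
  (eta_expmoment f g < +oo)%E.
Proof.
move=> gg; apply: le_lt_trans; apply: ge0_le_integral => //.
- by move=> u _; rewrite lee_fin mulr_ge0 ?expR_ge0.
- by apply/measurable_EFinP; exact: measurable_expMf fdens _.
- by apply/measurable_EFinP; exact: measurable_expMf fdens _.
- by move=> u u0; rewrite lee_fin ler_wpM2r // ler_expR ler_wpM2r.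
Qed.

End Laplace.

(** * The action of [attach] on powers *)

Section PowerSums.
Variables (R : realType) (mu : probability R R) (f : R -> R) (lam : R).
Hypothesis fdens : eta_density mu f.
Hypothesis lam0 : 0 < lam.
Hypothesis hL : hLaplace f lam = 1%E.
Hypothesis hE1 : (eta_expmoment f 1 < +oo)%E.

Notation leb := (@lebesgue_measure R).
Notation D := (@nonneg_reals R).

Let f0 u : 0 <= f u. Proof. by case: fdens => _ []. Qed.

Let E1 := fine (eta_expmoment f 1).

Let E1_ge0 : 0 <= E1.
Proof.
apply: fine_ge0; apply: integral_ge0 => u _; rewrite lee_fin mulr_ge0 ?expR_ge0 //.
Qed.

(** With x = n exp(- u), the functions exp((1 - lam) u) and exp(u) are multiples of x^(lam-1) and 1
    / x; they integrate against f to 2 lam and [E1]. *)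
Lemma attach_le_moments (n : nat) (g : nat -> R) (a b : R) :
  (forall u k, 0 <= u -> Num.floor (n%:R * expR (- u)) = k%:Z ->
     g (maxn k 1) / (2 * (maxn k 1)%:R - 1) <= a * expR ((1 - lam) * u) + b * expR u) ->
  attach mu n g <= a * (2 * lam) + b * E1.
Proof.
move=> hg.
have mom := expmoment_laplace fdens lam0 hL.
have i1 : leb.-integrable D (EFin \o (fun u => expR ((1 - lam) * u) * f u)).
  by apply: (integrable_expMf fdens); rewrite mom ltry.
have i2 := integrable_expMf fdens hE1.
have i1a : leb.-integrable D (EFin \o (fun u => a * (expR ((1 - lam) * u) * f u))).
  by apply: eq_integrable (integrableZl _ a i1) => //; exact: measurable_nonneg_reals.
have i2b : leb.-integrable D (EFin \o (fun u => b * (expR (1 * u) * f u))).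
  by apply: eq_integrable (integrableZl _ b i2) => //; exact: measurable_nonneg_reals.
have e : (fun u => (a * expR ((1 - lam) * u) + b * expR u) * f u) =
    (fun u => a * (expR ((1 - lam) * u) * f u) + b * (expR (1 * u) * f u)).
  by apply/funext => u; rewrite mul1r; ring.
have := @sum_qdelay_le _ mu f fdens n
  (fun k => g (maxn k 1) / (2 * (maxn k 1)%:R - 1))
  (fun u => a * expR ((1 - lam) * u) + b * expR u).
rewrite e => h; apply: le_trans (h _ hg) _.
  apply: eq_integrable (integrableD _ i1a i2b) => //; exact: measurable_nonneg_reals.
rewrite RintegralD //; last exact: measurable_nonneg_reals.
rewrite RintegralZl //; last exact: measurable_nonneg_reals.
rewrite RintegralZl //; last exact: measurable_nonneg_reals.
by rewrite {1}/Rintegral -/(eta_expmoment f (1 - lam)) mom.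
Qed.

Lemma powR_scaled (n : nat) (u : R) : (0 < n)%N ->
  (n%:R * expR (- u)) `^ (lam - 1) = n%:R `^ lam / n%:R * expR ((1 - lam) * u).
Proof.
move=> n0; have N0 : 0 < n%:R :> R by rewrite ltr0n.
rewrite powRM ?expR_ge0 // ?ler0n //; congr (_ * _).
  by rewrite powRD ?powR_inv1 ?ler0n //; apply/implyP; rewrite (gt_eqF N0).
by rewrite /powR gt_eqF ?expR_gt0 // expRK; congr expR; ring.
Qed.

Let lam1 : lam < 1. Proof. exact: (laplace_root_lt1 fdens lam0 hL). Qed.

(* With x = n exp(- u) and k = floor x, the summand is bounded by
   x^(lam-1) / 2 + 3 / x; the first term integrates to lam n^(lam-1). *)
Lemma attach_pow_le (n : nat) : (0 < n)%N ->
  attach mu n (fun k => k%:R `^ lam) <= (lam * n%:R `^ lam + 3 * E1) / n%:R.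
Proof.
move=> n0; have N0 : 0 < n%:R :> R by rewrite ltr0n.
have := @attach_le_moments n (fun k => k%:R `^ lam)
  (2^-1 * (n%:R `^ lam / n%:R)) (3 / n%:R).
have -> : 2^-1 * (n%:R `^ lam / n%:R) * (2 * lam) + 3 / n%:R * E1 =
   (lam * n%:R `^ lam + 3 * E1) / n%:R by field; rewrite gt_eqF.
apply=> u k u0 /floor_eq_nat /andP[].
rewrite -mulrA -powR_scaled //.
have -> : 3 / n%:R * expR u = 3 / (n%:R * expR (- u)).
  by rewrite expRN; field; rewrite !gt_eqF ?expR_gt0.
set x := _ * _ => kx xk.
have x0 : 0 < x by rewrite mulr_gt0 ?expR_gt0.
(* For k = 0 one has x < 1 and, as T(0) = T(1), the summand is 1, which is below 3 / x. *)
case: k kx xk => [|k] kx xk.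
  rewrite /= powR1 mulr1 (_ : 2 - 1 = 1 :> R); last by ring.
  rewrite divr1; apply: (@le_trans _ _ (3 / x)).
    by rewrite ler_pdivlMr // mul1r; move: xk; lra.
  by rewrite lerDr mulr_ge0 ?powR_ge0 // invr_ge0.
rewrite (maxn_idPl _) //.
set K : R := k.+1%:R in kx *.
have K1 : 1 <= K by rewrite ler1n.
have xK : x < K + 1 by move: xk; rewrite -natr1.
have -> : x `^ (lam - 1) = x `^ lam / x.
  by rewrite powRD ?powR_inv1 ?(ltW x0) //; apply/implyP; rewrite (gt_eqF x0).
have pKx : K `^ lam <= x `^ lam.
  by rewrite ge0_ler_powR ?nnegrE ?(ltW lam0) ?(ltW x0) //; lra.
have xx : x `^ lam <= x.
  by rewrite -[leRHS]powRr1 ?(ltW x0) // ler_powR ?(ltW lam1) //; lra.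
have d0 : 0 < 2 * K - 1 by lra.
apply: (@le_trans _ _ (x `^ lam / (2 * K - 1))).
  by rewrite ler_pM2r ?invr_gt0.
have p0 : 0 <= x `^ lam by exact: powR_ge0.
(* As x < K + 1, one has 2 K - 1 >= 2 x - 3; the resulting loss (3/2) x^lam <= (3/2) x is covered by
   3 (2 K - 1), since 2 K - 1 >= x / 2. *)
rewrite ler_pdivrMr // -(ler_pM2r x0).
have -> : (2^-1 * (x `^ lam / x) + 3 / x) * (2 * K - 1) * x =
  (2^-1 * x `^ lam + 3) * (2 * K - 1) by field; rewrite gt_eqF.
nra.
Qed.

(* The loss on k < m is at most x^(lam-1) / 2 <= m^lam / (2 x). *)
Lemma attach_pow_ge (n m : nat) : (0 < n)%N -> (0 < m)%N ->
  (lam * n%:R `^ lam - 2^-1 * E1 * m%:R `^ lam) / n%:R <=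
  attach mu n (fun k => if (m <= k)%N then k%:R `^ lam else 0).
Proof.
move=> n0 m0; have N0 : 0 < n%:R :> R by rewrite ltr0n.
(* [attach_le_moments] bounds from above, so it is applied to the negated function. *)
rewrite -lerN2.
have -> : - attach mu n (fun k => if (m <= k)%N then k%:R `^ lam else 0) =
   attach mu n (fun k => -1 * (if (m <= k)%N then k%:R `^ lam else 0)).
  by rewrite attachZ mulN1r.
have := @attach_le_moments n
  (fun k => -1 * (if (m <= k)%N then k%:R `^ lam else 0))
  (- (2^-1 * (n%:R `^ lam / n%:R))) (2^-1 * m%:R `^ lam / n%:R).
have -> : - (2^-1 * (n%:R `^ lam / n%:R)) * (2 * lam) + 2^-1 * m%:R `^ lam / n%:R * E1 =
   - ((lam * n%:R `^ lam - 2^-1 * E1 * m%:R `^ lam) / n%:R) by field; rewrite gt_eqF.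
apply=> u k u0 /floor_eq_nat /andP[].
rewrite [X in _ <= X + _]mulNr -[X in _ <= - X + _]mulrA -powR_scaled //.
have -> : 2^-1 * m%:R `^ lam / n%:R * expR u = 2^-1 * (m%:R `^ lam / (n%:R * expR (- u))).
  by rewrite expRN; field; rewrite !gt_eqF ?expR_gt0.
set x := n%:R * _ => kx xk.
have x0 : 0 < x by rewrite mulr_gt0 ?expR_gt0.
have -> : x `^ (lam - 1) = x `^ lam / x.
  by rewrite powRD ?powR_inv1 ?(ltW x0) //; apply/implyP; rewrite (gt_eqF x0).
have p0 : 0 <= x `^ lam by exact: powR_ge0.
case: (leqP m k) => mk; last first.
  apply: (@le_trans _ _ 0).
    rewrite mulN1r mulNr oppr_le0 divr_ge0 ?(ltW (den_gt0 _ _)) //.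
    by case: ifP => // _; exact: powR_ge0.
  rewrite addrC subr_ge0 ler_pM2l ?invr_gt0 // ler_pM2r ?invr_gt0 //.
  rewrite ge0_ler_powR ?nnegrE ?(ltW lam0) ?(ltW x0) //.
  by apply: ltW; apply: lt_le_trans xk _; rewrite ler_nat.
have k0 : (0 < k)%N by apply: leq_trans mk.
rewrite (maxn_idPl _) // mk.
set K : R := k%:R in kx *.
have K1 : 1 <= K by rewrite ler1n.
have q0 : 0 <= m%:R `^ lam / x by rewrite divr_ge0 ?powR_ge0 // ltW.
suff h : 2^-1 * (x `^ lam / x) <= K `^ lam / (2 * K - 1).
  by rewrite mulN1r mulNr; lra.
have -> : x `^ lam / x = x `^ (lam - 1).
  by rewrite powRD ?powR_inv1 ?(ltW x0) //; apply/implyP; rewrite (gt_eqF x0).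
have K0 : 0 < K by lra.
have h1 : x `^ (lam - 1) <= K `^ (lam - 1).
  rewrite -(opprB 1 lam) !powRN lef_pV2 ?posrE ?powR_gt0 //.
  by rewrite ge0_ler_powR ?nnegrE ?subr_ge0 ?(ltW lam1) ?(ltW x0) ?(ltW K0).
apply: (@le_trans _ _ (2^-1 * K `^ (lam - 1))); first by rewrite ler_pM2l ?invr_gt0.
rewrite powRD ?powR_inv1 ?(ltW K0) //; last by apply/implyP; rewrite (gt_eqF K0).
have P0 : 0 <= K `^ lam by exact: powR_ge0.
have d0 : 0 < 2 * K - 1 by lra.
rewrite mulrCA ler_wpM2l // -invfM lef_pV2 ?posrE; lra.
Qed.

(** Besides monotonicity and linearity of [attach], the barriers below rest on these two estimates.
    The summand 1 in the witness makes it positive. *)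
Lemma attach_pow_bounds : exists2 c : R, 0 < c & forall n : nat, (0 < n)%N ->
  attach mu n (fun k => k%:R `^ lam) <= (lam * n%:R `^ lam + c) / n%:R /\
  forall m : nat, (0 < m)%N -> (lam * n%:R `^ lam - c * m%:R `^ lam) / n%:R <=
    attach mu n (fun k => if (m <= k)%N then k%:R `^ lam else 0).
Proof.
exists (3 * E1 + 1); first by move: E1_ge0; lra.
move=> n n0; split=> [|m m0].
  apply: le_trans (attach_pow_le n0) _.
  by rewrite ler_pM2r ?invr_gt0 ?ltr0n // lerD2l; lra.
apply: le_trans (attach_pow_ge n0 m0).
rewrite ler_pM2r ?invr_gt0 ?ltr0n // lerD2l lerN2 ler_wpM2r ?powR_ge0 //.
by move: E1_ge0; lra.
Qed.

End PowerSums.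

(** * Super- and subsolutions of the mean recursion *)

(** Concavity: adding ln z <= z - 1 at z = x / y and z = 1 / y with weights a and 1 - a gives a ln x
    <= ln y for y = 1 + a (x - 1). *)
Lemma powR_le_bernoulli (R : realType) (x a : R) : 0 < x -> 0 <= a <= 1 ->
  x `^ a <= 1 + a * (x - 1).
Proof.
move=> x0 /andP[a0 a1]; pose y := 1 + a * (x - 1).
have y0 : 0 < y by rewrite /y; nra.
have lnle (z : R) : 0 < z -> ln z <= z - 1.
  by move=> z0; have := @le_ln1Dx R (z - 1); rewrite addrCA subrr addr0; apply; lra.
have h1 := lnle (x / y) (divr_gt0 x0 y0).
have h2 := lnle (y^-1) (ltac:(by rewrite invr_gt0)).
rewrite ln_div ?posrE // in h1; rewrite lnV ?posrE // in h2.
rewrite /powR gt_eqF // -/y -[leRHS]lnK ?posrE // ler_expR.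
have h3 : a * (x / y - 1) + (1 - a) * (y^-1 - 1) = 0.
  by rewrite /y; field; rewrite -/y gt_eqF.
nra.
Qed.

Section Barriers.
Variables (R : realType) (mu : probability R R) (lam c : R).
Hypothesis lam0 : 0 < lam.
Hypothesis lam1 : lam < 1.
Hypothesis c0 : 0 < c.

Definition pw (k : nat) : R := k%:R `^ lam.

Hypothesis attach_pw : forall n : nat, (0 < n)%N ->
  attach mu n pw <= (lam * pw n + c) / n%:R /\
  forall m : nat, (0 < m)%N -> (lam * pw n - c * pw m) / n%:R <=
    attach mu n (fun k => if (m <= k)%N then pw k else 0).

Lemma pw_gt0 k : (0 < k)%N -> 0 < pw k.
Proof. by move=> k0; rewrite powR_gt0 // ltr0n. Qed.

Lemma pw_ge0 k : 0 <= pw k. Proof. exact: powR_ge0. Qed.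

Lemma le_pw k l : (k <= l)%N -> pw k <= pw l.
Proof. by move=> kl; rewrite /pw ge0_ler_powR ?nnegrE ?ler_nat // ltW. Qed.

Lemma pw_ge1 k : (0 < k)%N -> 1 <= pw k.
Proof. by move=> k0; have := le_pw k0; rewrite {1}/pw powR1. Qed.

Lemma pw_le k : (0 < k)%N -> pw k <= k%:R.
Proof.
move=> k0; rewrite -[leRHS]powRr1 // /pw ler_powR ?(ltW lam1) // ler1n //.
Qed.

(** Bernoulli's inequality at n / (n + 1) and at (n + 1) / n. *)
Lemma pw_step n : (0 < n)%N ->
  pw n <= pw n.+1 * (1 - lam / n.+1%:R) /\ pw n.+1 <= pw n * (1 + lam / n%:R).
Proof.
move=> n0.
have N0 : 0 < n%:R :> R by rewrite ltr0n.
have M0 : 0 < n.+1%:R :> R by rewrite ltr0n.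
have l01 : 0 <= lam <= 1 by rewrite !ltW.
have e : n.+1%:R = n%:R + 1 :> R by rewrite natr1.
split.
  have := powR_le_bernoulli (divr_gt0 N0 M0) l01.
  rewrite powRM ?invr_ge0 ?(ltW N0) ?(ltW M0) // -powR_inv1 ?(ltW M0) //.
  rewrite -powRrM mulN1r powRN -/(pw n) -/(pw n.+1).
  rewrite ler_pdivrMr ?pw_gt0 // mulrC.
  move=> /le_trans; apply; rewrite le_eqVlt; apply/orP; left; apply/eqP; congr (_ * _).
  by rewrite powR_inv1 ?(ltW M0) // e; field; rewrite -e gt_eqF.
have := powR_le_bernoulli (divr_gt0 M0 N0) l01.
rewrite powRM ?invr_ge0 ?(ltW N0) ?(ltW M0) // -powR_inv1 ?(ltW N0) //.
rewrite -powRrM mulN1r powRN -/(pw n) -/(pw n.+1).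
rewrite ler_pdivrMr ?pw_gt0 // mulrC.
move=> /le_trans; apply; rewrite le_eqVlt; apply/orP; left; apply/eqP; congr (_ * _).
by rewrite powR_inv1 ?(ltW N0) // e; field; rewrite gt_eqF.
Qed.

(** A discrete form of the derivative of - x^(- lam), with half the constant. These increments pay
    for the errors in both barriers and later for the second-order term. *)
Lemma inv_pw_step n : (0 < n)%N ->
  lam / (2 * (n%:R * pw n)) <= (pw n)^-1 - (pw n.+1)^-1.
Proof.
move=> n0; have [h _] := pw_step n0.
have N1 : 1 <= n%:R :> R by rewrite ler1n.
have p0 := pw_gt0 n0; have q0 : 0 < pw n.+1 by exact: pw_gt0.
have e : n.+1%:R = n%:R + 1 :> R by rewrite natr1.
have h' : pw n <= pw n.+1 * (1 - lam / (2 * n%:R)).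
  apply: le_trans h _; rewrite ler_pM2l // lerD2l lerN2.
  rewrite ler_pM2l // lef_pV2 ?posrE ?ltr0n //; last by lra.
  by rewrite e; lra.
have -> : (pw n)^-1 - (pw n.+1)^-1 = (pw n.+1 - pw n) / (pw n * pw n.+1).
  by field; rewrite !gt_eqF.
rewrite ler_pdivlMr ?mulr_gt0 //.
have -> : lam / (2 * (n%:R * pw n)) * (pw n * pw n.+1) = pw n.+1 * (lam / (2 * n%:R)).
  by field; rewrite !gt_eqF //; lra.
by move: h'; lra.
Qed.

(** Chosen so that [Kup * lam / 2] is c + lam: c for the error in [attach_pw], lam for the
    discretisation of k^lam. *)
Definition Kup : R := 2 * c / lam + 2.
Definition upbar (k : nat) : R := pw k * expR (- (Kup / pw k)).

Lemma Kup_gt0 : 0 < Kup.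
Proof. by rewrite /Kup addr_gt0 // divr_gt0 // mulr_gt0. Qed.

Lemma upbar_le k : upbar k <= pw k.
Proof.
rewrite /upbar ler_piMr ?pw_ge0 // -expR0 ler_expR oppr_le0 divr_ge0 ?pw_ge0 //.
exact: ltW Kup_gt0.
Qed.

Lemma upbar_ge k : (0 < k)%N -> expR (- Kup) * pw k <= upbar k.
Proof.
move=> k0; rewrite mulrC ler_pM2l ?pw_gt0 // ler_expR lerN2.
rewrite ler_pdivrMr ?pw_gt0 // ler_peMr ?pw_ge1 // ltW ?Kup_gt0 //.
Qed.

(** The exponential factor increases in k, so it leaves [attach] at its value for k = n; its growth
    from n to n + 1 pays for the errors. *)
Lemma upbar_super n : (0 < n)%N -> upbar n + attach mu n upbar <= upbar n.+1.
Proof.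
move=> n0; have [h _] := attach_pw n0; have [h1 h2] := pw_step n0.
have N1 : 1 <= n%:R :> R by rewrite ler1n.
have p0 := pw_gt0 n0; have q0 : 0 < pw n.+1 by exact: pw_gt0.
have pq := le_pw (leqnSn n); have pn := pw_le n0.
have hi := inv_pw_step n0.
pose U := expR (- (Kup / pw n)).
have U0 : 0 < U by exact: expR_gt0.
have hA : attach mu n upbar <= U * ((lam * pw n + c) / n%:R).
  apply: (@le_trans _ _ (U * attach mu n pw)); last by rewrite ler_pM2l.
  rewrite -attachZ; apply: le_attach => // k /andP[k0 kn].
  rewrite /upbar mulrC ler_pM2r ?pw_gt0 // ler_expR lerN2 ler_pM2l ?Kup_gt0 //.
  by rewrite lef_pV2 ?posrE ?pw_gt0 // le_pw.
have hU : U * (1 + Kup * (lam / (2 * (n%:R * pw n)))) <= expR (- (Kup / pw n.+1)).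
  have -> : - (Kup / pw n.+1) = - (Kup / pw n) + Kup * ((pw n)^-1 - (pw n.+1)^-1) by ring.
  rewrite expRD ler_pM2l //; apply: le_trans (expR_ge1Dx _).
  by rewrite lerD2l ler_pM2l ?Kup_gt0.
have -> : upbar n = U * pw n by rewrite mulrC.
apply: (@le_trans _ _ (U * (pw n + (lam * pw n + c) / n%:R))).
  by rewrite mulrDr lerD2l.
apply: (@le_trans _ _ (pw n.+1 * (U * (1 + Kup * (lam / (2 * (n%:R * pw n))))))); last first.
  by rewrite ler_pM2l.
rewrite mulrCA ler_pM2l //.
have e : n.+1%:R = n%:R + 1 :> R by rewrite natr1.
have step1 : pw n + lam * (pw n / n%:R - n%:R^-1) <= pw n.+1.
  apply: (@le_trans _ _ (pw n + lam * (pw n.+1 / n.+1%:R))); last first.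
    by move: h1; move: (n.+1%:R^-1) => iM; lra.
  rewrite lerD2l ler_pM2l //.
  apply: (@le_trans _ _ (pw n / n.+1%:R)); last by rewrite ler_pM2r ?invr_gt0 ?ltr0n.
  have -> : pw n / n%:R - n%:R^-1 = (pw n - 1) / n%:R by rewrite mulrBl mul1r.
  rewrite ler_pdivrMr; last by lra.
  rewrite mulrAC ler_pdivlMr ?ltr0n // e; nra.
have step2 : Kup * (lam / (2 * n%:R)) <= pw n.+1 * (Kup * (lam / (2 * (n%:R * pw n)))).
  have -> : Kup * (lam / (2 * n%:R)) = pw n * (Kup * (lam / (2 * (n%:R * pw n)))).
    by field; rewrite !gt_eqF //; lra.
  rewrite ler_wpM2r // mulr_ge0 ?(ltW Kup_gt0) // divr_ge0 ?(ltW lam0) //.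
  by rewrite !mulr_ge0 ?(ltW p0) //; lra.
rewrite mulrDr mulr1; apply: le_trans (lerD step1 step2).
rewrite -addrA lerD2l le_eqVlt; apply/orP; left; apply/eqP; rewrite /Kup.
by field; rewrite !gt_eqF //; lra.
Qed.

(** With t = c pw m / (n pw n) the relative loss in one step, this constant makes [lowfac] shrink at
    least by the factor exp(- 2 t). *)
Definition Klow : R := 4 * c / lam.
Definition lowfac (m k : nat) : R := expR (Klow * pw m / pw k).
Definition lowbar (m k : nat) : R := if (m <= k)%N then pw k * lowfac m k else 0.

Lemma Klow_gt0 : 0 < Klow. Proof. by rewrite /Klow divr_gt0 ?mulr_gt0. Qed.

Lemma lowbar_ge0 m k : 0 <= lowbar m k.
Proof. by rewrite /lowbar; case: ifP => // _; rewrite mulr_ge0 ?pw_ge0 ?expR_ge0. Qed.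

Lemma lowbar_ge m k : (0 < m <= k)%N -> pw k <= lowbar m k.
Proof.
move=> /andP[m0 mk]; rewrite /lowbar mk ler_peMr ?pw_ge0 // /lowfac -expR0 ler_expR.
by rewrite !mulr_ge0 ?invr_ge0 ?pw_ge0 // ltW // Klow_gt0.
Qed.

Lemma lowbar_le m k : (0 < m)%N -> lowbar m k <= expR Klow * pw k.
Proof.
move=> m0; rewrite /lowbar; case: ifPn => mk; last by rewrite mulr_ge0 ?expR_ge0 ?pw_ge0.
have k0 : (0 < k)%N by apply: leq_trans mk.
rewrite mulrC ler_pM2r ?pw_gt0 // ler_expR -mulrA ler_piMr ?(ltW Klow_gt0) //.
by rewrite ler_pdivrMr ?pw_gt0 // mul1r le_pw.
Qed.

(** Here the exponential factor decreases in k, so its value at n is a lower bound inside [attach];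
    its decay from n to n + 1 makes up for the loss. The condition 2 c <= m ensures t <= 1/2. *)
Lemma lowbar_sub m n : (0 < m)%N -> 2 * c <= m%:R -> (m <= n)%N ->
  lowbar m n.+1 <= lowbar m n + attach mu n (lowbar m).
Proof.
move=> m0 cm mn; have n0 : (0 < n)%N by apply: leq_trans mn.
have [_ /(_ m m0) h] := attach_pw n0; have [h1 h2] := pw_step n0.
have N1 : 1 <= n%:R :> R by rewrite ler1n.
have p0 := pw_gt0 n0; have q0 : 0 < pw n.+1 by exact: pw_gt0.
have r0 := pw_gt0 m0; have rp := le_pw mn.
have hi := inv_pw_step n0.
pose V := lowfac m n; have V0 : 0 < V by exact: expR_gt0.
have hA : V * ((lam * pw n - c * pw m) / n%:R) <= attach mu n (lowbar m).
  apply: (@le_trans _ _ (V * attach mu n (fun k => if (m <= k)%N then pw k else 0))).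
    by rewrite ler_pM2l.
  rewrite -attachZ; apply: le_attach => // k /andP[k0 kn].
  rewrite /lowbar; case: ifP => mk; last by rewrite mulr0.
  rewrite mulrC ler_pM2l ?pw_gt0 // ler_expR ler_pM2l ?(mulr_gt0 Klow_gt0 r0) //.
  by rewrite lef_pV2 ?posrE ?pw_gt0 // le_pw.
pose t := c * pw m / (n%:R * pw n).
have t0 : 0 <= t by rewrite /t divr_ge0 ?mulr_ge0 ?(ltW r0) ?(ltW p0) ?(ltW c0) //; lra.
have t2 : t <= 2^-1.
  rewrite ler_pdivrMr ?mulr_gt0 //; last by lra.
  have mnR : m%:R <= n%:R :> R by rewrite ler_nat.
  nra.
have hV : lowfac m n.+1 <= V * (1 - t).
  have -> : lowfac m n.+1 = V * expR (- (Klow * pw m * ((pw n)^-1 - (pw n.+1)^-1))).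
    by rewrite /V /lowfac -expRD; congr expR; ring.
  rewrite ler_pM2l //.
  apply: (@le_trans _ _ (expR (- (2 * t)))).
    rewrite ler_expR lerN2.
    have -> : 2 * t = Klow * pw m * (lam / (2 * (n%:R * pw n))).
      by rewrite /t /Klow; field; rewrite !gt_eqF //; lra.
    by rewrite ler_pM2l ?(mulr_gt0 Klow_gt0 r0).
  (* exp(2 t) >= 1 + 2 t, and (1 + 2 t) (1 - t) >= 1 because t <= 1/2. *)
  rewrite expRN -[leRHS]invrK lef_pV2 ?posrE ?expR_gt0 ?invr_gt0 //; last by lra.
  apply: le_trans (expR_ge1Dx _).
  rewrite -[leLHS]mul1r ler_pdivrMr; last by lra.
  nra.
rewrite {1 2}/lowbar mn (leqW mn).
apply: (@le_trans _ _ (pw n * V + V * ((lam * pw n - c * pw m) / n%:R))); last first.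
  by rewrite lerD2l.
apply: (@le_trans _ _ (pw n.+1 * (V * (1 - t)))); first by rewrite ler_pM2l.
rewrite mulrCA (mulrC (pw n)) -mulrDr ler_pM2l //.
apply: (@le_trans _ _ (pw n * (1 + lam / n%:R) * (1 - t))).
  by rewrite ler_pM2r //; lra.
have -> : pw n + (lam * pw n - c * pw m) / n%:R = pw n * (1 + lam / n%:R) - pw n * t.
  by rewrite /t; field; rewrite !gt_eqF //; lra.
have : 0 <= lam / n%:R * (pw n * t).
  by rewrite mulr_ge0 ?(mulr_ge0 (ltW p0) t0) // divr_ge0 // ltW.
by clearbody t; lra.
Qed.

End Barriers.

(** * Backward weights for the Laplace transform *)

Section BackwardWeights.
Variables (R : realType) (mu : probability R R).
Hypothesis sum_q : forall n, \sum_(0 <= k < n.+1) qdelay mu n k = 1.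
Variables (n : nat) (theta : R).
Hypothesis theta0 : 0 <= theta.

(** The coefficient of [g k] in [attach j g]; i = 0 and i = 1 both contribute to k = 1, hence the
    filtered sum. *)
Definition coef (j k : nat) : R :=
  \sum_(0 <= i < j.+1 | maxn i 1 == k) qdelay mu j i / (2 * k%:R - 1).

Lemma sum_coef j g : (0 < j)%N ->
  \sum_(1 <= k < j.+1) coef j k * g k = attach mu j g.
Proof.
move=> j0; rewrite /coef /attach.
under eq_bigr => k _.
  rewrite mulr_suml big_mkcond /=; over.
rewrite exchange_big /= big_nat [RHS]big_nat; apply: eq_bigr => i /andP[_ ij].
rewrite (bigD1_seq (maxn i 1)) ?iota_uniq //=; last first.
  by rewrite mem_index_iota; move: ij j0; lia.
rewrite eqxx big1 ?addr0; first by rewrite mulrAC -mulrA.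
by move=> k; rewrite eq_sym => /negbTE ->.
Qed.

Lemma coef_ge0 j k : (0 < k)%N -> 0 <= coef j k.
Proof.
move=> k0; apply: sumr_ge0 => i _; rewrite divr_ge0 ?qdelay_ge0 //.
by have : 1 <= k%:R :> R; [rewrite ler1n|lra].
Qed.

(* [bw t k] is the weight of the degree X_k in the exponent after t backward steps
   from time n.  A step from time j + 1 to j uses
     E exp(- a Delta) <= exp(- (1 - exp(- a)) P(Delta = 1)),
   whose right-hand exponent is again linear in X_1, ..., X_j.  Only the values at
   1 <= k <= n - t are meaningful. *)
Fixpoint bw (t : nat) : nat -> R :=
  match t with
  | 0 => fun k => if k == n then theta else 0
  | t'.+1 => fun k =>
      bw t' k + (if k == (n - t'.+1)%N then bw t' (n - t'.+1).+1 else 0)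
      + (1 - expR (- bw t' (n - t'.+1).+1)) * coef (n - t'.+1) k
  end.

Definition pairing (t : nat) (g : nat -> R) : R :=
  \sum_(1 <= k < (n - t).+1) bw t k * g k.

Lemma bw_ge0 t k : (0 < k)%N -> 0 <= bw t k.
Proof.
elim: t k => [|t IH] k k0 /=; first by case: ifP.
rewrite !addr_ge0 ?IH //; first by case: ifP => // _; exact: IH.
rewrite mulr_ge0 ?coef_ge0 // subr_ge0 -[leRHS]expR0 ler_expR oppr_le0.
exact: IH.
Qed.

Lemma pairing0 g : (0 < n)%N -> pairing 0 g = theta * g n.
Proof.
move=> n0; rewrite /pairing subn0 big_nat_recr //= eqxx big_nat big1 ?add0r //.
by move=> k /andP[_ kn]; rewrite ltn_eqF ?mul0r.
Qed.

Lemma pairing_recr t j g : (0 < j)%N -> (n - t = j.+1)%N ->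
  pairing t g = \sum_(1 <= k < j.+1) bw t k * g k + bw t j.+1 * g j.+1.
Proof. by move=> j0 e; rewrite /pairing e big_nat_recr. Qed.

Lemma pairingS t j g : (0 < j)%N -> (n - t = j.+1)%N ->
  pairing t.+1 g = \sum_(1 <= k < j.+1) bw t k * g k + bw t j.+1 * g j
    + (1 - expR (- bw t j.+1)) * attach mu j g.
Proof.
move=> j0 e; have e' : (n - t.+1 = j)%N by rewrite subnS e.
rewrite /pairing e' -(sum_coef _ j0) mulr_sumr /= e'.
rewrite [X in _ + X + _](_ : _ = \sum_(1 <= k < j.+1)
    (if k == j then bw t j.+1 else 0) * g k).
  rewrite -!big_split /=; apply: eq_bigr => k _; rewrite !mulrDl; ring.
rewrite big_nat_recr //= eqxx big_nat big1 ?add0r //.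
by move=> k /andP[_ kn]; rewrite ltn_eqF ?mul0r.
Qed.

Lemma pairing_diff t j g : (0 < j)%N -> (n - t = j.+1)%N ->
  pairing t g - pairing t.+1 g =
  bw t j.+1 * (g j.+1 - g j) - (1 - expR (- bw t j.+1)) * attach mu j g.
Proof.
by move=> j0 e; rewrite (pairing_recr _ j0 e) (pairingS _ j0 e); ring.
Qed.

Lemma expect_pairing t j : (1 < j)%N -> (n - t = j.+1)%N ->
  expect mu j.+1 (fun s => expR (- pairing t (rootdeg R s))) <=
  expect mu j (fun s => expR (- pairing t.+1 (rootdeg R s))).
Proof.
move=> j1 e; have j0 : (0 < j)%N by apply: ltnW.
rewrite expectS //; apply: le_expect => s hs.
set a := bw t j.+1; set X := rootdeg R s.
pose S := \sum_(1 <= k < j.+1) bw t k * X k + a * X j.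
have eS i : pairing t (rootdeg R (rcons s i)) = S + a * (i == 1%N)%:R.
  rewrite (pairing_recr _ j0 e) (rootdeg_rcons_last R i j0 hs) mulrDr addrA.
  congr (_ + _ + _); rewrite !big_nat; apply: eq_bigr => k /andP[_ kj].
  by rewrite (rootdeg_rcons R i j0 hs).
pose phi (b : bool) := expR (- S) * (if b then expR (- a) else 1).
rewrite (eq_bigr (fun i => trans mu s j i * phi (i == 1%N))); last first.
  move=> i _; rewrite eS opprD expRD; congr (_ * (_ * _)).
  by case: (i == 1%N); rewrite ?mulr1 ?mulr0 ?oppr0 ?expR0.
rewrite (sum_trans_root sum_q phi j0 hs) /phi mulr1 -/X (pairingS _ j0 e) -/a -/S [X in _ <= expR X]opprD [X in _ <= X]expRD.
rewrite [leLHS](_ : _ = expR (- S) * (1 + - ((1 - expR (- a)) * attach mu j X))).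
  by rewrite ler_pM2l ?expR_gt0 //; exact: expR_ge1Dx.
by move=> /=; ring.
Qed.

(** Backward steps down to time m; there all weights but the top one are dropped, being
    nonnegative. *)
Lemma expect_pairing_chain m : (1 < m <= n)%N ->
  expect mu n (fun s => expR (- (theta * rootdeg R s n))) <=
  expect mu m (fun s => expR (- (bw (n - m) m * rootdeg R s m))).
Proof.
move=> /andP[m1 mn]; have n0 : (0 < n)%N by move: m1 mn; lia.
have chain t : (t <= n - m)%N ->
  expect mu n (fun s => expR (- (theta * rootdeg R s n))) <=
  expect mu (n - t) (fun s => expR (- pairing t (rootdeg R s))).
  elim: t => [_|t IH tm].
    by rewrite subn0; apply: le_expect => s _; rewrite pairing0.
  apply: le_trans (IH (ltnW tm)) _.
  have e : (n - t = (n - t.+1).+1)%N by move: tm; lia.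
  rewrite e; apply: expect_pairing => //; by move: tm m1; lia.
apply: le_trans (chain _ (leqnn _)) _.
rewrite subKn //; apply: le_expect => s _; rewrite ler_expR lerN2.
have m0 : (0 < m)%N by apply: ltnW.
rewrite /pairing subKn // big_nat_recr //= lerDr big_nat.
apply: sumr_ge0 => k /andP[k1 _]; by rewrite mulr_ge0 ?bw_ge0.
Qed.

(** The pairing with a supersolution does not grow under a backward step, as 1 - exp(- a) <= a; at
    time m only its top term is kept. *)
Lemma bw_super m g : (0 < m <= n)%N -> (forall k, 0 <= g k) ->
  (forall j, (m <= j)%N -> g j + attach mu j g <= g j.+1) ->
  bw (n - m) m * g m <= theta * g n.
Proof.
move=> /andP[m0 mn] g0 gS; have n0 : (0 < n)%N by apply: leq_trans mn.
have chain t : (t <= n - m)%N -> pairing t g <= theta * g n.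
  elim: t => [_|t IH tm]; first by rewrite pairing0.
  apply: le_trans (IH (ltnW tm)); rewrite -subr_ge0.
  have e : (n - t = (n - t.+1).+1)%N by move: tm; lia.
  have mj : (m <= n - t.+1)%N by move: tm; lia.
  rewrite (pairing_diff _ _ e); last by apply: leq_trans mj.
  set j := (n - t.+1)%N in mj *; set a := bw t j.+1.
  have a0 : 0 <= a by exact: bw_ge0.
  have ea : 1 - expR (- a) <= a by have := expR_ge1Dx (- a); lra.
  have A0 := attach_ge0 mu j g0.
  have h := gS _ mj; nra.
apply: le_trans (chain _ (leqnn _)).
rewrite /pairing subKn // big_nat_recr //= lerDr big_nat.
by apply: sumr_ge0 => k /andP[k1 _]; rewrite mulr_ge0 ?bw_ge0.
Qed.

(** The pairing with a subsolution loses at most a^2 [attach mu j g] per step, which the decrements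
    of the potential [v] cover. Since g vanishes below m, only the top term is left at time m. *)
Lemma bw_sub m g (v : nat -> R) : (0 < m <= n)%N ->
  (forall k, 0 <= g k) -> (forall k, (k < m)%N -> g k = 0) ->
  (forall j, (m <= j)%N -> g j.+1 <= g j + attach mu j g) ->
  (forall j, (m <= j < n)%N ->
     bw (n - j.+1) j.+1 ^+ 2 * attach mu j g <= v j - v j.+1) ->
  theta * g n <= bw (n - m) m * g m + (v m - v n).
Proof.
move=> /andP[m0 mn] g0 gm gS hv; have n0 : (0 < n)%N by apply: leq_trans mn.
have chain t : (t <= n - m)%N -> theta * g n <= pairing t g + (v (n - t)%N - v n).
  elim: t => [_|t IH tm]; first by rewrite pairing0 // subn0 subrr addr0.
  apply: le_trans (IH (ltnW tm)) _.
  have e : (n - t = (n - t.+1).+1)%N by move: tm; lia.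
  have mj : (m <= n - t.+1)%N by move: tm; lia.
  have hd := @pairing_diff t _ g (leq_trans m0 mj) e.
  rewrite e; set j := (n - t.+1)%N in mj e hd *; set a := bw t j.+1 in hd.
  have hv' : a ^+ 2 * attach mu j g <= v j - v j.+1.
    have := hv j; rewrite (_ : n - j.+1 = t)%N; last by move: tm e; lia.
    by apply; move: mj e; lia.
  have a0 : 0 <= a by exact: bw_ge0.
  have A0 := attach_ge0 mu j g0.
  have ea : a - (1 - expR (- a)) <= a ^+ 2.
    have : expR (- a) <= (1 + a)^-1.
      by rewrite expRN lef_pV2 ?posrE ?expR_gt0 ?expR_ge1Dx //; lra.
    have : (1 + a)^-1 <= 1 - a + a ^+ 2.
      rewrite -[leLHS]mul1r ler_pdivrMr; last by lra.
      by have a3 : 0 <= a ^+ 3 := exprn_ge0 _ a0; lra.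
    lra.
  have h := gS _ mj.
  have h1 : a * (g j.+1 - g j) <= a * attach mu j g by apply: ler_wpM2l => //; lra.
  have h2 := ler_wpM2r A0 ea.
  by rewrite mulrBl in h2; lra.
apply: le_trans (chain _ (leqnn _)) _.
rewrite subKn // lerD2r /pairing subKn // big_nat_recr //= -lerBrDr subrr big_nat.
by apply: sumr_le0 => k /andP[k1 km]; rewrite gm // mulr0.
Qed.

End BackwardWeights.

(** Boundedness identifies [limn_sup] with the infimum of the tail suprema. *)
Lemma limn_sup_le (R : realType) (u : nat -> R) (N : nat) (b : R) :
  (forall n, 0 <= u n <= 1) -> (forall n, (N <= n)%N -> u n <= b) ->
  limn_sup u <= b.
Proof.
move=> u01 ub.
have bu : bounded_fun (u : nat -> R^o).
  exists 1; split; first exact: num_real.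
  move=> y y1 n _ /=; have /andP[u0 u1] := u01 n.
  by rewrite ger0_norm //; apply: le_trans u1 (ltW y1).
rewrite limn_supE //; apply: (@le_trans _ _ (sups u N)).
  apply: ge_inf; last by exists N.
  exists 0 => _ [n _ <-]; have /andP[u0 _] := u01 n.
  apply: le_trans u0 _; apply: ub_le_sup; last by exists n => /=.
  by exists 1 => _ [k _ <-]; have /andP[] := u01 k.
apply: ge_sup; first by exists (u N), N => /=.
by move=> _ [n Nn <-]; exact: ub.
Qed.

(** * Tail bounds *)

Section Tails.
Variables (R : realType) (mu : probability R R) (lam c : R).
Hypothesis lam0 : 0 < lam.
Hypothesis lam1 : lam < 1.
Hypothesis c0 : 0 < c.
Hypothesis sum_q : forall n, \sum_(0 <= k < n.+1) qdelay mu n k = 1.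
Hypothesis attach_pw : forall n : nat, (0 < n)%N ->
  attach mu n (pw lam) <= (lam * pw lam n + c) / n%:R /\
  forall m : nat, (0 < m)%N -> (lam * pw lam n - c * pw lam m) / n%:R <=
    attach mu n (fun k => if (m <= k)%N then pw lam k else 0).

Lemma probRootDeg01 n E : 0 <= probRootDeg mu n E <= 1.
Proof.
rewrite probRootDeg_ge0 /=; case: n => [|[|n]]; last exact: probRootDeg_le1.
- by rewrite /probRootDeg /= big_seq1 /wt big_geq // mul1r; case: (E _).
- by rewrite /probRootDeg /= big_seq1 /wt big_geq // mul1r; case: (E _).
Qed.

Lemma meandeg_le_pw : exists2 C : R, 0 < C &
  forall n, (0 < n)%N -> meandeg mu n <= C * pw lam n.
Proof.
(* With this factor the barrier is at least 2 everywhere, which covers the mean degrees 1 and 2 at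
   the start. *)
pose C := 2 * expR (Kup lam c); have C0 : 0 < C by rewrite mulr_gt0 ?expR_gt0.
exists C => // n n0.
suff h N : (1 < N)%N -> forall k, (0 < k <= N)%N -> meandeg mu k <= C * upbar lam c k.
  apply: (@le_trans _ _ (C * upbar lam c n)); last by rewrite ler_pM2l ?upbar_le.
  by apply: (h n.+1) => //; rewrite n0 leqnSn.
have base k : (0 < k)%N -> 2 <= C * upbar lam c k.
  move=> k0; have h := upbar_ge lam0 c0 k0; have p1 := pw_ge1 lam0 k0.
  apply: (@le_trans _ _ (C * (expR (- Kup lam c) * pw lam k))); last by rewrite ler_pM2l.
  rewrite /C -mulrA (mulrA (expR _)) -expRD subrr expR0 mul1r; lra.
elim: N => [//|N IH]; rewrite leq_eqVlt => /orP[/eqP <- k /andP[k0 k2]|N1 k /andP[k0]].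
  apply: le_trans (base k k0).
  case: k k0 k2 => [//|[|[|//]]] _ _; first by rewrite /meandeg /=; lra.
  by rewrite /meandeg /= expect2 /rootdeg /deg.
rewrite leq_eqVlt => /orP[/eqP ->|kN]; last by apply: IH => //; rewrite k0.
have N0 : (0 < N)%N by apply: ltnW.
rewrite meandegS //; apply: le_trans (_ : C * (upbar lam c N + attach mu N (upbar lam c)) <= _).
  rewrite mulrDr; apply: lerD; first by apply: IH => //; rewrite N0 /=.
  by rewrite -attachZ; apply: le_attach => // i iN; exact: IH.
by rewrite ler_pM2l //; exact: upbar_super.
Qed.

Lemma upper_tail : exists2 C1 : R, 0 < C1 & forall A : R, 0 < A ->
  limn_sup (fun n : nat => probRootDeg mu n (fun M => A * n%:R `^ lam < M%:R))
    <= C1 / A `^ (1 / (lam + 1)).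
Proof.
have [C C0 hC] := meandeg_le_pw; exists (C + 1); first lra.
have l1 : 0 < lam + 1 by rewrite addr_gt0.
have a0 : 0 <= 1 / (lam + 1) by rewrite divr_ge0 // ltW.
have a1 : 1 / (lam + 1) <= 1 by rewrite ler_pdivrMr // mul1r lerDr ltW.
move=> A A0; apply: (@limn_sup_le _ _ 2); first by move=> n; exact: probRootDeg01.
move=> n n2; have n0 : (0 < n)%N by apply: ltnW.
have P0 : 0 < A `^ (1 / (lam + 1)) by exact: powR_gt0.
rewrite ler_pdivlMr //.
(* For A <= 1 the right-hand side exceeds 1; for A > 1 Markov's bound C / A suffices, as
   A^(1/(lam+1)) <= A. *)
case: (leP A 1) => A1.
  have PA : A `^ (1 / (lam + 1)) <= 1.
    have := @ge0_ler_powR R (1 / (lam + 1)) a0 A 1; rewrite powR1 !nnegrE.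
    by apply; rewrite ?(ltW A0).
  have /andP[h0 h1] := probRootDeg01 n (fun M => A * n%:R `^ lam < M%:R).
  apply: (@le_trans _ _ 1); last lra.
  by rewrite mulr_ile1 ?(ltW P0).
have PA : A `^ (1 / (lam + 1)) <= A.
  by rewrite -[leRHS]powRr1 ?(ltW A0) // ler_powR // ltW.
have q0 : 0 < A * pw lam n by rewrite mulr_gt0 ?pw_gt0.
have h : probRootDeg mu n (fun M => A * n%:R `^ lam < M%:R) <= C / A.
  rewrite probRootDegE; apply: (@le_trans _ _ ((A * pw lam n)^-1 * meandeg mu n)).
    rewrite -(expect_rootdeg sum_q n2); last by rewrite n0 leqnn.
    rewrite -expectZ; apply: le_expect => s _; rewrite -/(pw lam n).
    rewrite [leRHS]mulrC ler_pdivlMr //.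
    have [hlt|_] := ltP (A * pw lam n) (deg s 1 n)%:R; first by rewrite mul1r ltW.
    by rewrite mul0r ler0n.
  rewrite mulrC ler_pdivrMr //.
  have -> : C / A * (A * pw lam n) = C * pw lam n by field; rewrite gt_eqF.
  exact: hC.
have /andP[h0 _] := probRootDeg01 n (fun M => A * n%:R `^ lam < M%:R).
apply: (@le_trans _ _ (C / A * A)); first by apply: ler_pM => //; exact: ltW.
by rewrite divfK ?gt_eqF //; lra.
Qed.

Lemma laplace_chain : exists e a : R, [/\ 0 < e, 0 < a &
  forall m n : nat, (1 < m <= n)%N -> 2 * c <= m%:R ->
  expect mu n (fun s => expR (- (e * pw lam m / pw lam n * rootdeg R s n))) <=
  expect mu m (fun s => expR (- (a * rootdeg R s m)))].
Proof.
pose K := Kup lam c; pose L := Klow lam c.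
(* [Q] is fitted so that the quadratic error in [bw_sub] is at most the decrement of the potential
   [v] below. *)
pose Q := 2 * (expR K ^+ 2 * expR L * (lam + c)) / lam.
have eK : 0 < expR K by exact: expR_gt0.
have eL : 0 < expR L by exact: expR_gt0.
have Q0 : 0 < Q by rewrite divr_gt0 // !mulr_gt0 ?exprn_gt0 // addr_gt0.
have QE : Q = 2 * (expR K ^+ 2 * expR L * (lam + c)) / lam by [].
clearbody Q.
(* This [e] maximises e - e^2 Q, with value 1 / (4 Q); dividing by [expR L] gives [a]. *)
pose e := (2 * Q)^-1; have e0 : 0 < e by rewrite invr_gt0 mulr_gt0.
pose a := (4 * Q * expR L)^-1; have a0 : 0 < a by rewrite invr_gt0 !mulr_gt0.
exists e, a; split=> // m n /andP[m1 mn] cm.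
have m0 : (0 < m)%N by apply: ltnW.
have n0 : (0 < n)%N by apply: leq_trans mn.
have pm := pw_gt0 lam m0; have pn := pw_gt0 lam n0.
pose th := e * pw lam m / pw lam n.
have th0 : 0 < th by rewrite divr_gt0 ?mulr_gt0.
have hmn : (1 < m <= n)%N by rewrite m1.
apply: le_trans (expect_pairing_chain sum_q (ltW th0) hmn) _.
pose top i := bw mu n th (n - i) i.
have top_le i : (0 < i <= n)%N -> top i <= e * expR K * pw lam m / pw lam i.
  move=> /andP[i0 i_n]; have pi := pw_gt0 lam i0.
  have h : top i * upbar lam c i <= th * upbar lam c n.
    apply: bw_super => //; first exact: ltW.
    - by rewrite i0.
    - by move=> k; rewrite mulr_ge0 ?pw_ge0 ?expR_ge0.
    - by move=> j ij; apply: upbar_super => //; apply: leq_trans ij.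
  have t0 : 0 <= top i by apply: bw_ge0 => //; exact: ltW.
  have h1 := upbar_ge lam0 c0 i0; have h2 := upbar_le lam0 c0 n.
  have h3 : top i * (expR (- K) * pw lam i) <= th * pw lam n.
    apply: le_trans (ler_wpM2l t0 h1) _; apply: le_trans h _.
    by rewrite ler_pM2l.
  rewrite ler_pdivlMr //.
  have -> : e * expR K * pw lam m = expR K * (th * pw lam n).
    by rewrite /th divfK ?gt_eqF //; ring.
  rewrite -ler_pdivrMl //; apply: le_trans h3; rewrite expRN -/K.
  by rewrite le_eqVlt; apply/orP; left; apply/eqP; ring.
pose v j := e ^+ 2 * Q * pw lam m ^+ 2 / pw lam j.
have main : th * lowbar lam c m n <= top m * lowbar lam c m m + (v m - v n).
  apply: bw_sub => //; first exact: ltW.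
  - by rewrite m0.
  - by move=> k; exact: lowbar_ge0.
  - by move=> k km; rewrite /lowbar leqNgt km.
  - by move=> j mj; apply: lowbar_sub.
  move=> j /andP[mj jn]; have j0 : (0 < j)%N by apply: leq_trans mj.
  have pj := pw_gt0 lam j0; have J1 : 1 <= j%:R :> R by rewrite ler1n.
  have J0 : 0 < j%:R :> R by lra.
  have hA : attach mu j (lowbar lam c m) <= expR L * ((lam + c) * pw lam j / j%:R).
    apply: (@le_trans _ _ (expR L * attach mu j (pw lam))).
      by rewrite -attachZ; apply: le_attach => // k _; exact: lowbar_le.
    rewrite ler_pM2l //; have [h _] := attach_pw j0; apply: le_trans h _.
    rewrite ler_pM2r ?invr_gt0 // mulrDl lerD2l ler_peMr ?(ltW c0) //.
    exact: pw_ge1.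
  have A0 : 0 <= attach mu j (lowbar lam c m).
    by apply: attach_ge0 => k; exact: lowbar_ge0.
  have t0 : 0 <= top j.+1 by apply: bw_ge0 => //; exact: ltW.
  have hT : top j.+1 <= e * expR K * pw lam m / pw lam j.
    apply: le_trans (top_le j.+1 _) _; first by rewrite jn.
    rewrite ler_pM2l ?lef_pV2 ?posrE ?pw_gt0 //; first by apply: le_pw.
    by rewrite !mulr_gt0.
  have hT2 : top j.+1 ^+ 2 <= (e * expR K * pw lam m / pw lam j) ^+ 2.
    by rewrite ler_pXn2r ?nnegrE //; apply: le_trans hT.
  apply: le_trans (ler_pM (sqr_ge0 _) A0 hT2 hA) _.
  have hi := inv_pw_step lam0 lam1 j0.
  have -> : v j - v j.+1 = e ^+ 2 * Q * pw lam m ^+ 2 * ((pw lam j)^-1 - (pw lam j.+1)^-1).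
    by rewrite /v; ring.
  have z0 : 0 < e ^+ 2 * Q * pw lam m ^+ 2 by rewrite !mulr_gt0 ?exprn_gt0.
  rewrite -(ler_pM2l z0) in hi; apply: le_trans hi.
  rewrite le_eqVlt; apply/orP; left; apply/eqP; rewrite QE.
  by field; rewrite !gt_eqF.
have hn : pw lam n <= lowbar lam c m n by apply: lowbar_ge; rewrite // m0.
have hm := lowbar_le lam0 c0 m m0.
have tm0 : 0 <= top m by apply: bw_ge0 => //; exact: ltW.
have vn0 : 0 <= v n by rewrite divr_ge0 ?(ltW pn) // (mulr_ge0 (mulr_ge0 (sqr_ge0 _) (ltW Q0)) (sqr_ge0 _)).
have key : e <= top m * expR L + e ^+ 2 * Q.
  rewrite -(ler_pM2r pm).
  have -> : e * pw lam m = th * pw lam n by rewrite /th divfK // gt_eqF.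
  have -> : (top m * expR L + e ^+ 2 * Q) * pw lam m = top m * (expR L * pw lam m) + v m.
    by rewrite /v; field; rewrite gt_eqF.
  have h1 : th * pw lam n <= th * lowbar lam c m n by rewrite ler_pM2l.
  have h2 := ler_wpM2l tm0 hm.
  lra.
have atop : a <= top m.
  have -> : a = (e - e ^+ 2 * Q) / expR L.
    by rewrite /a /e; field; rewrite !gt_eqF.
  by rewrite ler_pdivrMr //; lra.
apply: le_expect => s _; rewrite ler_expR lerN2 ler_wpM2r //.
Qed.

(* Every degree is at least 1, so v_(n+1) joins the root with probability at
   least 1 / (2 n). *)
Lemma expect_expN_decay (a : R) (n : nat) : 0 < a -> (1 < n)%N ->
  expect mu n (fun s => expR (- (a * rootdeg R s n))) <=
  (2 / n%:R) `^ ((1 - expR (- a)) / 2).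
Proof.
move=> a0; set b := (1 - _) / 2.
have b0 : 0 < b by rewrite divr_gt0 // subr_gt0 -[ltRHS]expR0 ltr_expR oppr_lt0.
elim: n => [//|n IH]; rewrite leq_eqVlt => /orP[/eqP <-|n1].
  (* The normalisation 2 / n makes the bound 1 at the starting time 2. *)
  rewrite expect2 divff // powR1 -[leRHS]expR0 ler_expR oppr_le0 mulr_ge0 ?(ltW a0) //.
have n0 : (0 < n)%N by apply: ltnW.
have N0 : 0 < n%:R :> R by rewrite ltr0n.
have M0 : 0 < n.+1%:R :> R by rewrite ltr0n.
apply: (@le_trans _ _ (expR (- (b / n%:R)) *
    expect mu n (fun s => expR (- (a * rootdeg R s n))))).
  rewrite -expectZ expectS //; apply: le_expect => s hs.
  pose phi (i : bool) := expR (- (a * rootdeg R s n)) * (if i then expR (- a) else 1).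
  rewrite (eq_bigr (fun i => trans mu s n i * phi (i == 1%N))); last first.
    move=> i _; rewrite (rootdeg_rcons_last R i n0 hs) mulrDr opprD expRD /phi.
    by congr (_ * (_ * _)); case: (i == 1%N); rewrite ?mulr1 ?mulr0 ?oppr0 ?expR0.
  rewrite (sum_trans_root sum_q phi n0 hs) /phi.
  rewrite [leLHS](_ : _ = (1 + - ((1 - expR (- a)) * attach mu n (rootdeg R s))) *
    expR (- (a * rootdeg R s n))); last by move=> /=; ring.
  rewrite ler_pM2r ?expR_gt0 //; apply: le_trans (expR_ge1Dx _) _.
  rewrite ler_expR lerN2.
  have := attach_rootdeg_ge sum_q s n0.
  have -> : b / n%:R = (1 - expR (- a)) * (2 * n%:R)^-1 by rewrite /b invfM; ring.
  by apply: ler_wpM2l; move: b0; rewrite /b; lra.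
apply: (@le_trans _ _ (expR (- (b / n%:R)) * (2 / n%:R) `^ b)).
  by rewrite ler_pM2l ?expR_gt0 // IH.
have two0 : 0 < 2 :> R by [].
rewrite /powR !gt_eqF ?divr_gt0 // -expRD ler_expR !ln_div ?posrE //.
(* After taking logarithms, the claim reduces to log(1 + 1 / n) <= 1 / n. *)
have hl : ln n.+1%:R - ln n%:R <= n%:R^-1 :> R.
  rewrite -ln_div ?posrE // -natr1 mulrDl divff ?gt_eqF // mul1r.
  by apply: le_ln1Dx; apply: lt_trans (_ : 0 < _); rewrite ?invr_gt0.
have := ler_wpM2l (ltW b0) hl; lra.
Qed.

(* Apply laplace_chain with m of order x^(- 1 / lam). *)
Lemma lower_tail : exists C1 C2 : R, [/\ 0 < C1, 0 < C2 & forall x : R, 0 < x ->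
  limn_sup (fun n : nat => probRootDeg mu n (fun M => M%:R < x * n%:R `^ lam))
    <= C1 * x `^ C2].
Proof.
have [e [a [e0 a0 chain]]] := laplace_chain.
pose b : R := (1 - expR (- a)) / 2.
have b0 : 0 < b by rewrite divr_gt0 // subr_gt0 -[ltRHS]expR0 ltr_expR oppr_lt0.
have bE : (1 - expR (- a)) / 2 = b by [].
clearbody b.
(* From [m1] on, both conditions of the chain hold: m >= 2 and 2 c <= m. *)
pose m1 := (Num.truncn (2 * c)).+2.
have m1c : 2 * c <= m1%:R.
  by apply: le_trans (ltW (truncnS_gt _)) _; rewrite ler_nat.
have M1 : 1 <= m1%:R :> R by rewrite ler1n.
exists (expR 1 * ((4 * m1%:R) `^ b * e `^ (b / lam))), (b / lam); split.
- by rewrite !mulr_gt0 ?expR_gt0 ?powR_gt0 // mulr_gt0 //; lra.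
- by rewrite divr_gt0.
(* Since z^lam = e x, the integer part m of 1 / z satisfies e m^lam x <= 1. *)
move=> x x0; pose z := (e * x) `^ lam^-1.
have z0 : 0 < z by rewrite powR_gt0 // mulr_gt0.
have zlam : z `^ lam = e * x.
  by rewrite -powRrM mulVf ?gt_eqF // powRr1 // mulr_ge0 ?ltW.
have -> : expR 1 * ((4 * m1%:R) `^ b * e `^ (b / lam)) * x `^ (b / lam) =
    expR 1 * (4 * m1%:R * z) `^ b.
  rewrite -[LHS]mulrA -[X in _ * X = _]mulrA; congr (_ * _).
  rewrite -(powRM _ (ltW e0) (ltW x0)) (mulrC b) powRrM -/z.
  by rewrite -powRM ?(ltW z0) // mulr_ge0.
pose m := Num.truncn z^-1.
have m_le : m%:R <= z^-1 by rewrite truncn_le // invr_ge0 ltW.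
have m_gt : z^-1 < m.+1%:R by exact: truncnS_gt.
(* If m < m1, then 1 / z < m1 and the right-hand side is at least 1. *)
case: (leqP m1 m) => mm; last first.
  apply: (@limn_sup_le _ _ 0); first by move=> n; exact: probRootDeg01.
  move=> n _; have /andP[_ h] := probRootDeg01 n (fun M => M%:R < x * n%:R `^ lam).
  apply: le_trans h _; apply: (@le_trans _ _ (expR 1 * 1)).
    by rewrite mulr1 -expR0 ler_expR.
  rewrite ler_pM2l ?expR_gt0 // -[leLHS](_ : 1 `^ b = 1 :> R); last by rewrite powR1.
  apply: ge0_ler_powR; rewrite ?nnegrE ?(ltW b0) //.
    by rewrite !mulr_ge0 ?(ltW z0).
  have : z^-1 < m1%:R by apply: lt_le_trans m_gt _; rewrite ler_nat.
  rewrite -[X in X < _]mul1r ltr_pdivrMr //; lra.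
have m2 : (1 < m)%N by apply: leq_trans mm.
have m0 : (0 < m)%N by apply: ltnW.
apply: (@limn_sup_le _ _ m); first by move=> n; exact: probRootDeg01.
move=> n mn; have n0 : (0 < n)%N by apply: leq_trans mn.
have pn := pw_gt0 lam n0; have pm := pw_gt0 lam m0.
have M0 : 0 < m%:R :> R by rewrite ltr0n.
have xm : e * pw lam m <= x^-1.
  have : pw lam m <= z^-1 `^ lam.
    by rewrite ge0_ler_powR ?nnegrE ?(ltW lam0) ?invr_ge0 ?(ltW z0).
  rewrite -powR_inv1 ?(ltW z0) // -powRrM mulN1r powRN zlam invfM => h.
  rewrite -(ler_pM2l e0) in h; apply: le_trans h _.
  by rewrite mulrA divff ?mul1r // gt_eqF.
(* Exponential Markov inequality: on the event the exponent is at least -1, whence the factor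
   [expR 1]. *)
apply: (@le_trans _ _ (expR 1 * expect mu n
    (fun s => expR (- (e * pw lam m / pw lam n * rootdeg R s n))))).
  rewrite probRootDegE -expectZ; apply: le_expect => s _.
  rewrite -/(pw lam n).
  have [hlt|_] := ltP _ (x * pw lam n); last by rewrite mulr_ge0 ?expR_ge0.
  rewrite -expRD -[leLHS]expR0 ler_expR subr_ge0 mulrAC ler_pdivrMr // mul1r.
  apply: (@le_trans _ _ (x^-1 * (x * pw lam n))).
    by apply: ler_pM; rewrite ?ler0n ?mulr_ge0 ?(ltW e0) ?(ltW pm) ?(ltW hlt).
  by rewrite mulrA mulVf ?mul1r // gt_eqF.
rewrite ler_pM2l ?expR_gt0 //.
apply: le_trans (chain m n _ _) _; first by rewrite m2.
  by apply: le_trans m1c _; rewrite ler_nat.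
apply: le_trans (expect_expN_decay a0 m2) _; rewrite bE.
apply: ge0_ler_powR; rewrite ?nnegrE ?(ltW b0) ?divr_ge0 //.
  by rewrite !mulr_ge0 ?(ltW z0).
rewrite ler_pdivrMr //.
(* As m + 1 <= 2 m, this gives 2 / m < 4 z, and m1 >= 1. *)
have h1 : z^-1 < 2 * m%:R.
  apply: lt_le_trans m_gt _; rewrite -natr1; have : 1 <= m%:R :> R by rewrite ler1n.
  lra.
have h2 : 1 <= 2 * m%:R * z by move: h1; rewrite -[X in X < _]mul1r ltr_pdivrMr // => /ltW.
nra.
Qed.

End Tails.

Theorem theorem4p11 (R : realType) (mu : probability R R) (f : R -> R) (lam : R) :
  mu `[0, 1]%classic = 1%E ->
  (mu [set 0%R] < 1%E)%E ->
  eta_density mu f ->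
  (exists K : R, forall u : R, 0 <= u -> expR u * f u <= K) ->
  assumptionA f lam ->
  ((forall g : R, 0 < g -> (eta_expmoment f g < +oo)%E) ->
     exists2 C1 : R, 0 < C1 &
       forall A : R, 0 < A ->
         limn_sup (fun n : nat =>
           probRootDeg mu n (fun M => A * n%:R `^ lam < M%:R))
         <= C1 / A `^ (1 / (lam + 1)))
  /\
  ((exists2 g : R, 1 < g & (eta_expmoment f g < +oo)%E) ->
     exists C1 C2 : R, [/\ 0 < C1, 0 < C2 &
       forall x : R, 0 < x ->
         limn_sup (fun n : nat =>
           probRootDeg mu n (fun M => M%:R < x * n%:R `^ lam))
         <= C1 * x `^ C2]).
Proof.
move=> _ _ fdens _ [_ lam0 hL _ _].
have lam1 := laplace_root_lt1 fdens lam0 hL.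
have sum_q := sum_qdelay fdens.
(* E exp(eta) is finite in both parts: in (a) by taking gamma = 1, in (b) by monotonicity in the
   exponent. *)
split=> [hg|[g g1 hg]].
  have [c c0 hc] := attach_pow_bounds fdens lam0 hL (hg 1 ltr01).
  exact: (upper_tail lam0 lam1 c0 sum_q hc).
have [c c0 hc] := attach_pow_bounds fdens lam0 hL (expmoment_fin fdens (ltW g1) hg).
exact: (lower_tail lam0 lam1 c0 sum_q hc).
Qed.
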